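(* Let $\lambda\in\mathcal M$ and $\mu$ be nonzero finite Borel measures on $S^{n-1}$ not concentrated on any closed hemisphere, and let $\Theta=(G,\Psi,\lambda)$. Suppose either (a) $\Psi\in\mathcal C_I$ with $\lim_{t\to\infty}\Psi(\xi,t)=+\infty$ for each $\xi\in S^{n-1}$, and $G\in\mathscr G_d$; or (b) $G\in\mathcal C_d$ with $\lim_{t\to0^+}G(\xi,t)=+\infty$ for each $\xi\in S^{n-1}$, and $\Psi\in\mathscr G_I$. Then there exists $K\in\mathscr K^n_{(o)}$ such that $$\frac{\mu}{|\mu|}=\frac{\widetilde C_\Theta(K,\cdot)}{\widetilde C_\Theta(K,S^{n-1})}.$$ If in addition $\lambda$ is strictly positive on nonempty open subsets of $S^{n-1}$, then for a nonzero finite Borel measure $\mu$, the condition that $\mu$ is not concentrated on any closed hemisphere is also necessary for this equality to hold for some $K\in\mathscr K^n_{(o)}$.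
   Context: $S^{n-1}$ unit sphere of $\mathbb R^n$, $n\ge2$, $d\xi$ spherical Lebesgue measure, $|\mu|=\mu(S^{n-1})$. $\mathscr K^n_{(o)}$: compact convex sets with the origin in their interior. For $K$: $h_K(x)=\max\{x\cdot y:y\in K\}$, $\rho_K(x)=\max\{t\ge0:tx\in K\}$; $\pmb\alpha_K(\xi)$ set of outer unit normals of $K$ at $\rho_K(\xi)\xi$, singleton $\{\alpha_K(\xi)\}$ for a.e. $\xi$; $\pmb\alpha^*_K(\omega)=\{\xi:\pmb\alpha_K(\xi)\cap\omega\ne\emptyset\}$. $\mathcal C$: $G:S^{n-1}\times(0,\infty)\to\mathbb R$ with $G,G_t=\partial G/\partial t$ continuous; $\mathcal C_I=\{G_t>0\}$, $\mathcal C_d=\{G_t<0\}$. $\mathscr G_I$: $G\in\mathcal C$ with values in $(0,\infty)$ and, for each $u$, $G_t(u,\cdot)>0$, $\lim_{t\to0^+}G(u,t)=0$, $\lim_{t\to\infty}G(u,t)=\infty$. $\mathscr G_d$: $G\in\mathcal C$ with values in $(0,\infty)$ and, for each $u$, $G_t(u,\cdot)<0$, $\lim_{t\to0^+}G(u,t)=\infty$, $\lim_{t\to\infty}G(u,t)=0$. $\mathcal M$: nonzero finite Borel measures absolutely continuous w.r.t. $d\xi$. Musielak–Orlicz–Gauss image measure: $\widetilde C_\Theta(K,\omega)=\int_{\pmb\alpha^*_K(\omega)}\frac{\rho_K(\xi)G_t(\xi,\rho_K(\xi))}{h_K(\alpha_K(\xi))\Psi_t(\alpha_K(\xi),h_K(\alpha_K(\xi)))}d\lambda(\xi)$.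 Not concentrated on any closed hemisphere: $\int(u\cdot\xi)_+d\mu(\xi)>0$ for all $u\in S^{n-1}$. *)

(* Defs.v *)
From HB Require Import structures.
From mathcomp Require Import all_boot all_order all_algebra.
From mathcomp Require Import all_classical all_reals all_analysis.

Set Implicit Arguments.
Unset Strict Implicit.
Unset Printing Implicit Defensive.

Import Order.TTheory GRing.Theory Num.Theory.
Import numFieldNormedType.Exports.

Local Open Scope classical_set_scope.
Local Open Scope ring_scope.

Section Defs.
Variables (R : realType) (n : nat).

(* R^n is modelled by row vectors 'rV[R]_n (product topology = Euclidean). *)
Definition dotv (x y : 'rV[R]_n) : R := \sum_(i < n) x ord0 i * y ord0 i.

Definition sphere : set 'rV[R]_n := [set x | dotv x x = 1].

(* Borel sets of R^n: sigma-algebra generated by the open sets.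
   A Borel measure on S^{n-1} is represented as a Borel measure on R^n
   vanishing outside S^{n-1}. *)
Definition Borel := g_sigma_algebraType (@open 'rV[R]_n).

(* ---- spherical Lebesgue measure: null sets ----
   d xi(omega) = n * Vol_n({t x : x in omega, 0 < t <= 1}); hence omega is
   d xi-null iff this cone has n-dimensional Lebesgue (outer) measure 0. *)
Definition box (a b : 'rV[R]_n) : set 'rV[R]_n :=
  [set x | forall i, a ord0 i <= x ord0 i <= b ord0 i].

Definition box_vol (a b : 'rV[R]_n) : R := \prod_(i < n) (b ord0 i - a ord0 i).

Definition lebesgue_null (A : set 'rV[R]_n) : Prop :=
  forall eps : R, 0 < eps -> exists a b : nat -> 'rV[R]_n,
    (forall k i, a k ord0 i <= b k ord0 i) /\
    A `<=` \bigcup_k box (a k) (b k) /\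
    (forall N, \sum_(k < N) box_vol (a k) (b k) <= eps).

Definition cone (omega : set 'rV[R]_n) : set 'rV[R]_n :=
  [set y | exists x t, omega x /\ sphere x /\ 0 < t /\ t <= 1 /\ y = t *: x].

Definition spherical_null (omega : set 'rV[R]_n) : Prop :=
  lebesgue_null (cone omega).

Definition on_sphere (mu : {measure set Borel -> \bar R}) : Prop :=
  mu (~` sphere) = 0%E.

Definition nonzero_finite_sphere_measure (mu : {measure set Borel -> \bar R}) : Prop :=
  on_sphere mu /\ (0 < mu sphere)%E /\ (mu sphere < +oo)%E.

Definition in_M (lam : {measure set Borel -> \bar R}) : Prop :=
  nonzero_finite_sphere_measure lam /\
  (forall omega : set Borel, measurable omega -> omega `<=` sphere ->
     spherical_null omega -> lam omega = 0%E).

Definition not_concentrated (mu : {measure set Borel -> \bar R}) : Prop :=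
  forall u : 'rV[R]_n, sphere u ->
    (0 < \int[mu]_(xi in sphere) (Num.max (dotv u xi) 0)%:E)%E.

Definition positive_on_open (mu : {measure set Borel -> \bar R}) : Prop :=
  forall U : set 'rV[R]_n, open U -> (U `&` sphere) !=set0 ->
    (0 < mu (U `&` sphere))%E.

Definition dt (G : 'rV[R]_n -> R -> R) (u : 'rV[R]_n) (t : R) : R := derive1 (G u) t.

Definition dom_St : set ('rV[R]_n * R) := [set p | sphere p.1 /\ 0 < p.2].

Definition in_C (G : 'rV[R]_n -> R -> R) : Prop :=
  (forall u t, sphere u -> 0 < t -> derivable (G u) t 1) /\
  {within dom_St, continuous (fun p => G p.1 p.2)} /\
  {within dom_St, continuous (fun p => dt G p.1 p.2)}.

Definition in_CI (G : 'rV[R]_n -> R -> R) : Prop :=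
  in_C G /\ (forall u t, sphere u -> 0 < t -> 0 < dt G u t).

Definition in_Cd (G : 'rV[R]_n -> R -> R) : Prop :=
  in_C G /\ (forall u t, sphere u -> 0 < t -> dt G u t < 0).

Definition in_GI (G : 'rV[R]_n -> R -> R) : Prop :=
  in_C G /\
  (forall u t, sphere u -> 0 < t -> 0 < G u t) /\
  (forall u, sphere u ->
     [/\ forall t, 0 < t -> 0 < dt G u t,
         G u t @[t --> 0^'+] --> 0
       & G u t @[t --> +oo] --> +oo]).

Definition in_Gd (G : 'rV[R]_n -> R -> R) : Prop :=
  in_C G /\
  (forall u t, sphere u -> 0 < t -> 0 < G u t) /\
  (forall u, sphere u ->
     [/\ forall t, 0 < t -> dt G u t < 0,
         G u t @[t --> 0^'+] --> +oo
       & G u t @[t --> +oo] --> 0]).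

Definition convex_set (K : set 'rV[R]_n) : Prop :=
  forall x y (t : R), K x -> K y -> 0 <= t -> t <= 1 -> K (t *: x + (1 - t) *: y).

Definition in_Ko (K : set 'rV[R]_n) : Prop :=
  compact K /\ convex_set K /\ (interior K) 0.

Definition support (K : set 'rV[R]_n) (x : 'rV[R]_n) : R :=
  sup [set dotv x y | y in K].

Definition radial (K : set 'rV[R]_n) (x : 'rV[R]_n) : R :=
  sup [set t | 0 <= t /\ K (t *: x)].

Definition normals (K : set 'rV[R]_n) (xi : 'rV[R]_n) : set 'rV[R]_n :=
  [set v | sphere v /\ dotv (radial K xi *: xi) v = support K v].

Definition alpha_star (K : set 'rV[R]_n) (omega : set 'rV[R]_n) : set 'rV[R]_n :=
  [set xi | sphere xi /\ exists v, normals K xi v /\ omega v].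

(* alpha_K(xi): the (a.e. unique) outer unit normal; an arbitrary choice of
   normal where it is not unique (a d xi-null, hence lambda-null, set). *)
Definition alpha (K : set 'rV[R]_n) (xi : 'rV[R]_n) : 'rV[R]_n :=
  xget 0 (normals K xi).

Definition MOG_density (G Psi : 'rV[R]_n -> R -> R) (K : set 'rV[R]_n)
    (xi : 'rV[R]_n) : R :=
  let r := radial K xi in
  let a := alpha K xi in
  (r * dt G xi r) / (support K a * dt Psi a (support K a)).

Definition MOG_measure (G Psi : 'rV[R]_n -> R -> R)
    (lam : {measure set Borel -> \bar R}) (K : set 'rV[R]_n)
    (omega : set 'rV[R]_n) : \bar R :=
  (\int[lam]_(xi in (alpha_star K omega : set Borel))
      (MOG_density G Psi K xi)%:E)%E.

Definition normalized_eq (G Psi : 'rV[R]_n -> R -> R)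
    (lam mu : {measure set Borel -> \bar R}) (K : set 'rV[R]_n) : Prop :=
  forall omega : set Borel, measurable omega -> omega `<=` sphere ->
    fine (mu omega) / fine (mu sphere) =
    fine (MOG_measure G Psi lam K omega) / fine (MOG_measure G Psi lam K sphere).

End Defs.

(* Main.v *)
Require Import Defs.
From HB Require Import structures.
From mathcomp Require Import all_boot all_order all_algebra.
From mathcomp Require Import all_classical all_reals all_analysis.
From mathcomp Require Import measurable_realfun.
From mathcomp Require Import ring lra zify.

Set Implicit Arguments.
Unset Strict Implicit.
Unset Printing Implicit Defensive.

Import Order.TTheory GRing.Theory Num.Theory.
Import numFieldNormedType.Exports.

Local Open Scope classical_set_scope.
Local Open Scope ring_scope.

(* Encode a body by its support function [h] and its gauge [g = 1 / rho]. With
   [Gam (xi, s) = G (xi, 1 / s)] both hypotheses say that [Psi] and [Gam] are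
   increasing in the second variable and tend to infinity, and that one of the
   two is positive. Minimize the functional of the other one, among [\int Psi
   (h) dmu] and [\int Gam (g) dlam], under an upper bound on the functional of
   the positive one: since neither measure is concentrated on a hemisphere,
   bounds on both functionals confine [h] and [g] to a compact range, and a
   minimizer exists by Blaschke selection. At the minimizer no perturbation
   decreases both functionals. Perturbing to [h / (1 - t phi)] makes [1 / h]
   affine in [t], and the derivative of the gauge is [- phi (alpha) g] wherever
   the normal [alpha] is unique, which is a.e. because a convex function has a
   kink only on a null set. The resulting Lagrange relation, for all continuous
   [phi], identifies [mu] with a multiple of the image measure. For necessity,
   all normals at directions near [u] form an acute angle with [u], so the
   image measure charges every open hemisphere. *)

(** * Geometry of the sphere and polarity *)

(** The functional that is not assumed positive could be unbounded below. A bound on the positive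
    one repairs this: if [h u] is small, then [g x >= dotv u x / h u] is large on a cap around [u],
    so bounding [\int Gam (g) dlam] keeps [h] away from 0, and monotonicity bounds [Psi (h)] from
    below. Only then does coercivity apply to the second functional. With [h] and [g] exchanged the
    same argument serves case (b), and both cases end in one symmetric condition: no polar pair
    strictly lowers both functionals.

    A perturbed [h] need not be a support function. Its double dual is one, has the same gauge on
    the sphere and is no larger, so it can replace the perturbation.

    The constant perturbation moves the two functionals strictly in opposite directions; this
    supplies the nondegeneracy behind the Lagrange relation. Since [G] decreases, the image measure
    is nonpositive, and its sign cancels in the normalized quotient. *)

Section Dot.
Variables (R : realType) (n : nat).
Implicit Types x y z u v : 'rV[R]_n.

Lemma dotvC x y : dotv x y = dotv y x.
Proof. by apply: eq_bigr => i _; rewrite mulrC. Qed.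

Lemma dotvDl x y z : dotv (x + y) z = dotv x z + dotv y z.
Proof. by rewrite -big_split; apply: eq_bigr => i _; rewrite mxE mulrDl. Qed.

Lemma dotvZl (a : R) x y : dotv (a *: x) y = a * dotv x y.
Proof. by rewrite /dotv mulr_sumr; apply: eq_bigr => i _; rewrite mxE mulrA.
  Qed.

Lemma dotvDr x y z : dotv x (y + z) = dotv x y + dotv x z.
Proof. by rewrite !(dotvC x) dotvDl. Qed.

Lemma dotvZr (a : R) x y : dotv x (a *: y) = a * dotv x y.
Proof. by rewrite !(dotvC x) dotvZl. Qed.

Lemma dotvNl x y : dotv (- x) y = - dotv x y.
Proof. by rewrite -scaleN1r dotvZl mulN1r. Qed.

Lemma dotvNr x y : dotv x (- y) = - dotv x y.
Proof. by rewrite !(dotvC x) dotvNl. Qed.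

Lemma dotvBl x y z : dotv (x - y) z = dotv x z - dotv y z.
Proof. by rewrite dotvDl dotvNl. Qed.

Lemma dotvBr x y z : dotv x (y - z) = dotv x y - dotv x z.
Proof. by rewrite dotvDr dotvNr. Qed.

Lemma dotv0l x : dotv 0 x = 0.
Proof. by rewrite -(scale0r x) dotvZl mul0r. Qed.

Lemma dotvv_ge0 x : 0 <= dotv x x.
Proof. by apply: sumr_ge0 => i _; rewrite -expr2 sqr_ge0. Qed.

Lemma ler_coord_norm x i : `|x ord0 i| <= `|x|.
Proof.
rewrite [leRHS]/Num.norm /= mx_normrE; apply/bigmax_geP; right => /=.
by exists (ord0, i).
Qed.

Lemma norm_rV_le x (c : R) : 0 <= c -> (forall i, `|x ord0 i| <= c) ->
  `|x| <= c.
Proof.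
move=> c0 h; rewrite /Num.norm /= mx_normrE; apply/bigmax_leP; split => //=.
by move=> [i j] _ /=; rewrite (ord1 i).
Qed.

(** The norm of row vectors is the sup norm, hence the factor [n]; this crude form of Cauchy-Schwarz
    suffices for all continuity and boundedness estimates. *)
Lemma dotv_norm x y : `|dotv x y| <= n%:R * `|x| * `|y|.
Proof.
rewrite (le_trans (ler_norm_sum _ _ _))//.
have -> : n%:R * `|x| * `|y| = \sum_(i < n) `|x| * `|y|.
  by rewrite sumr_const card_ord -mulrA mulr_natl.
by apply: ler_sum => i _; rewrite normrM ler_pM ?ler_coord_norm.
Qed.

Lemma dotv_eq0 x : dotv x x = 0 -> x = 0.
Proof.
move=> /eqP; rewrite psumr_eq0 => [/allP h|i _]; last by rewrite -expr2 sqr_ge0.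
apply/rowP => i; rewrite mxE; have := h i (mem_index_enum i).
by rewrite mulf_eq0 orbb => /eqP.
Qed.

Lemma dotv_gt0 x : x != 0 -> 0 < dotv x x.
Proof.
move=> x0; rewrite lt_neqAle dotvv_ge0 andbT eq_sym;
  apply/eqP => /dotv_eq0 /eqP.
by rewrite (negbTE x0).
Qed.

(* AM-GM replaces Cauchy-Schwarz on unit vectors. *)
Lemma dotv_le1 u v : sphere u -> sphere v -> dotv u v <= 1.
Proof.
rewrite /sphere /= => hu hv; have := dotvv_ge0 (u - v).
by rewrite dotvBl !dotvBr hu hv (dotvC v u); lra.
Qed.

Lemma dotv_sqrB x z (t : R) :
  dotv (x - t *: z) (x - t *: z) = dotv x x - 2 * t * dotv x z + t ^+ 2 * dotv z
    z.
Proof. by rewrite dotvBl !dotvBr !dotvZl !dotvZr (dotvC z x); ring. Qed.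

Lemma sphereN u : sphere u -> sphere (- u).
Proof. by rewrite /sphere /= dotvNl dotvNr opprK. Qed.

Lemma sphere_coord u i : sphere u -> `|u ord0 i| <= 1.
Proof.
move=> hu; rewrite -sqrtr_sqr -[leRHS]sqrtr1 ler_wsqrtr//
  -hu /dotv (bigD1 i)//=.
by rewrite -expr2 lerDl; apply: sumr_ge0 => j _; rewrite -expr2 sqr_ge0.
Qed.

Lemma sphere_norm u : sphere u -> `|u| <= 1.
Proof. by move=> hu; apply: norm_rV_le => // i; exact: sphere_coord. Qed.

Lemma dotv_sphere_norm u x : sphere u -> `|dotv u x| <= n%:R * `|x|.
Proof.
move=> hu; rewrite (le_trans (dotv_norm _ _))// ler_wpM2r// ler_piMr//.
exact: sphere_norm.
Qed.

Lemma sphere_normalize x : x != 0 ->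
  exists t, 0 < t /\ sphere (t *: x).
Proof.
move=> /dotv_gt0 x0; exists (Num.sqrt (dotv x x))^-1.
rewrite invr_gt0 sqrtr_gt0; split => //; rewrite /sphere /= dotvZl dotvZr mulrA.
by rewrite -invfM -expr2 sqr_sqrtr ?mulVf ?gt_eqF// ltW.
Qed.

Lemma continuous_dotv (T : topologicalType) (f g : T -> 'rV[R]_n) :
  continuous f -> continuous g -> continuous (fun t => dotv (f t) (g t)).
Proof.
move=> cf cg t; rewrite /dotv.
apply: cvg_big => [|i _]; [exact: add_continuous|apply: cvgM].
  by apply: (@continuous_comp _ _ _ f (fun x => x ord0 i));
    [exact: cf|exact: coord_continuous].
by apply: (@continuous_comp _ _ _ g (fun x => x ord0 i));
  [exact: cg|exact: coord_continuous].
Qed.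

Lemma continuous_dotvl x : continuous (fun u : 'rV[R]_n => dotv u x).
Proof.
apply: (@continuous_dotv _ id (cst x)); last exact: cst_continuous.
by move=> t; exact: (@cvg_id _ (nbhs t)).
Qed.

Lemma continuous_dotvr u : continuous (fun x : 'rV[R]_n => dotv u x).
Proof.
rewrite (_ : (fun x => dotv u x) = (fun x => dotv x u));
  first exact: continuous_dotvl.
by apply/funext => x; rewrite dotvC.
Qed.

Lemma closed_sphere : closed (@sphere R n).
Proof.
have -> : @sphere R n = (fun x => dotv x x) @^-1` [set 1] by [].
apply: preimage_closed; last exact: closed_eq.
by move=> x _; apply: (@continuous_dotv _ id id) => t;
  exact: (@cvg_id _ (nbhs t)).
Qed.

Lemma compact_sphere : compact (@sphere R n).
Proof.
apply: bounded_closed_compact; last exact: closed_sphere.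
exists 1; split => // M M1 x /sphere_norm x1; exact: le_trans (ltW M1).
Qed.

End Dot.

Lemma sphere_nonempty (R : realType) (n : nat) : (@sphere R n.+1) !=set0.
Proof.
exists (\row_i (i == ord0)%:R);
  rewrite /sphere /= /dotv (bigD1 ord0)//= !mxE eqxx mulr1.
rewrite big1 ?addr0// => i /negbTE i0; by rewrite !mxE i0 mul0r.
Qed.

Section Dual.
Variables (R : realType) (n : nat).
Local Notation V := 'rV[R]_n.+1.
Local Notation S := (@sphere R n.+1).
Implicit Types (h g : V -> R) (e : R) (x y u : V).

(* When [h > 0] on the sphere, this is the gauge of the Wulff shape
   [{x | forall u, S u -> dotv u x <= h u}]. *)
Definition dual h x : R := sup [set dotv u x / h u | u in S].

(** The bounds are reciprocal to each other so that duality, which inverts them, preserves the class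
    with the same [e]. *)
Definition pinched e h : Prop := forall u, S u -> e <= h u <= e^-1.

Lemma pinched_le e e' h : 0 < e' -> e' <= e -> pinched e h -> pinched e' h.
Proof.
move=> e'0 e'e hh u /hh /andP[h1 h2]; rewrite (le_trans e'e)//= (le_trans h2)//.
by rewrite lef_pV2 ?posrE// (lt_le_trans e'0).
Qed.

Lemma pinched_gt0 e h u : 0 < e -> pinched e h -> S u -> 0 < h u.
Proof. by move=> e0 hh /hh /andP[h1 _]; exact: lt_le_trans h1. Qed.

Lemma eq_dual h h' : (forall u, S u -> h u = h' u) -> dual h = dual h'.
Proof.
move=> hh; apply/funext => x; rewrite /dual; congr sup.
by apply/seteqP; split => _ [u Su <-]; exists u => //; rewrite hh.
Qed.

Section Pos.
Variables (e : R) (h : V -> R).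
Hypotheses (e0 : 0 < e) (hle : forall u, S u -> e <= h u).

Let h0 u : S u -> 0 < h u.
Proof. by move=> /hle; exact: lt_le_trans. Qed.

Lemma dual_term_le u x : S u -> `|dotv u x / h u| <= n.+1%:R / e * `|x|.
Proof.
move=> Su; rewrite normrM normfV (gtr0_norm (h0 Su)) -mulrAC.
apply: ler_pM => //; first by rewrite invr_ge0 ltW ?h0.
  exact: dotv_sphere_norm.
by rewrite lef_pV2 ?posrE ?h0 ?hle.
Qed.

Lemma dual_has_sup x : has_sup [set dotv u x / h u | u in S].
Proof.
split; first by have [u Su] := sphere_nonempty R n; exists (dotv u x / h u), u.
exists (n.+1%:R / e * `|x|) => _ [u Su <-].
by apply: le_trans (dual_term_le _ Su); exact: ler_norm.
Qed.

Lemma dual_ub u x : S u -> dotv u x / h u <= dual h x.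
Proof. by move=> Su; apply: ub_le_sup; [case: (dual_has_sup x)|exists u]. Qed.

Lemma dual_ubM u x : S u -> dotv u x <= dual h x * h u.
Proof. by move=> Su; rewrite -ler_pdivrMr ?h0//; exact: dual_ub. Qed.

Lemma dual_le x c : (forall u, S u -> dotv u x / h u <= c) -> dual h x <= c.
Proof.
move=> H; apply: ge_sup; first by case: (dual_has_sup x).
by move=> _ [u Su <-]; exact: H.
Qed.

Lemma dual_ge0 x : 0 <= dual h x.
Proof.
have [u Su] := sphere_nonempty R n.
have [ux|ux] := leP 0 (dotv u x).
  by apply: le_trans (dual_ub _ Su); rewrite divr_ge0// ltW// h0.
apply: le_trans (dual_ub _ (sphereN Su)).
by rewrite dotvNl divr_ge0// ?oppr_ge0 ltW// h0//; exact: sphereN.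
Qed.

Lemma dualD x y : dual h (x + y) <= dual h x + dual h y.
Proof.
apply: dual_le => u Su; rewrite dotvDr mulrDl.
by apply: lerD; exact: dual_ub.
Qed.

Lemma dualZ t x : 0 <= t -> dual h (t *: x) = t * dual h x.
Proof.
move=> t0; have ge s y : 0 <= s -> dual h (s *: y) <= s * dual h y.
  move=> s0; apply: dual_le => u Su; rewrite dotvZr -mulrA.
  by apply: ler_wpM2l => //; exact: dual_ub.
apply/eqP; rewrite eq_le ge//=; have [->|tn0] := eqVneq t 0.
  by rewrite mul0r dual_ge0.
have tp : 0 < t by rewrite lt_neqAle eq_sym tn0.
rewrite -ler_pdivlMl//; have := ge t^-1 (t *: x).
by rewrite scalerA mulVf// scale1r; apply; rewrite invr_ge0.
Qed.

Lemma dual_abs_le x : `|dual h x| <= n.+1%:R / e * `|x|.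
Proof.
rewrite ger0_norm ?dual_ge0//; apply: dual_le => u Su.
by apply: le_trans (dual_term_le _ Su); exact: ler_norm.
Qed.

Lemma dual_lip x y : `|dual h x - dual h y| <= n.+1%:R / e * `|x - y|.
Proof.
suff H a b : dual h a - dual h b <= n.+1%:R / e * `|a - b|.
  by rewrite ler_norml H lerNl opprB distrC H.
rewrite lerBlDr; have := dualD (a - b) b; rewrite subrK => /le_trans; apply.
rewrite lerD2r.
by apply: le_trans (dual_abs_le _); exact: ler_norm.
Qed.

Lemma dual_continuous : continuous (dual h).
Proof.
move=> x; apply/(@cvgrPdist_le _ _ _ (nbhs x)) => d d0;
  have L0 : 0 < n.+1%:R / e by rewrite divr_gt0.
have r0 : 0 < (n.+1%:R / e)^-1 * d by rewrite mulr_gt0 ?invr_gt0.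
apply: filterS (nbhsx_ballx x _ r0) => y; rewrite -ball_normE /= => /ltW xy.
by apply: le_trans (dual_lip _ _) _; rewrite -ler_pdivlMl.
Qed.

Lemma dual_ge_sphere x : S x -> (h x)^-1 <= dual h x.
Proof. by move=> Sx; apply: le_trans (dual_ub x Sx);
  rewrite (_ : dotv x x = 1)// div1r. Qed.

Lemma dual_le_sphere x : S x -> dual h x <= e^-1.
Proof.
move=> Sx; apply: dual_le => u Su; rewrite -[e^-1]mul1r.
apply: (@le_trans _ _ (1 / h u));
  last by rewrite ler_pM2l// lef_pV2 ?posrE ?h0 ?hle.
by rewrite ler_pM2r ?invr_gt0 ?h0// dotv_le1.
Qed.

End Pos.

Section Pinched.
Variables (e : R).
Hypotheses (e0 : 0 < e).

Lemma pinched_lb h : pinched e h -> forall u, S u -> e <= h u.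
Proof. by move=> hh u /hh /andP[]. Qed.
Hint Resolve pinched_lb : core.

Lemma pinched_dual h : pinched e h -> pinched e (dual h).
Proof.
move=> hh x Sx; rewrite (dual_le_sphere e0)//; last exact: pinched_lb.
rewrite andbT; apply: le_trans (dual_ge_sphere e0 (pinched_lb hh) Sx).
have h0 := pinched_gt0 e0 hh Sx.
by rewrite -[e]invrK lef_pV2 ?posrE ?invr_gt0//; case/andP: (hh _ Sx).
Qed.

Lemma dual_dual_le h u : pinched e h -> S u -> dual (dual h) u <= h u.
Proof.
move=> hh Su; have hh' := pinched_dual hh.
apply: (dual_le e0); first exact: pinched_lb.
move=> x Sx; rewrite ler_pdivrMr ?(pinched_gt0 e0 hh')// dotvC mulrC.
by apply: (dual_ubM e0) => //; exact: pinched_lb.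
Qed.

Lemma dual_anti h h' x : pinched e h -> pinched e h' ->
  (forall u, S u -> h u <= h' u) -> dual h' x <= dual h x.
Proof.
move=> hh hh' le; apply: (dual_le e0); first exact: pinched_lb.
move=> u Su; have [ux|ux] := leP 0 (dotv u x).
  apply: le_trans (dual_ub e0 (pinched_lb hh) x Su).
  by rewrite ler_wpM2l// lef_pV2 ?posrE ?le// ?(pinched_gt0 e0 hh)
    ?(pinched_gt0 e0 hh').
(* A negative numerator reverses the comparison of quotients, but such a term lies below 0
   anyway. *)
apply: (@le_trans _ _ 0); last exact: (dual_ge0 e0 (pinched_lb hh)).
by rewrite mulr_le0_ge0// ltW// invr_gt0 (pinched_gt0 e0 hh').
Qed.

(** Duality is an antitone Galois connection: applied to [dual (dual h) <= h] it gives one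
    inequality, and [dual_dual_le] for [dual h] is the other. Passing from a function to its double
    dual therefore leaves the gauge unchanged on the sphere. *)
Lemma dual3 h : pinched e h -> forall x, S x ->
  dual (dual (dual h)) x = dual h x.
Proof.
move=> hh x Sx; have hh1 := pinched_dual hh; have hh2 := pinched_dual hh1.
apply/eqP; rewrite eq_le dual_dual_le//=; apply: dual_anti => // u Su.
exact: dual_dual_le.
Qed.

(** Each quotient [dotv u x / h u] moves by at most [d / e ^+ 2], because [dotv u x] is at most 1 in
    absolute value and inversion has Lipschitz constant [e ^- 2] above [e]; a supremum moves no more
    than its terms. *)
Lemma dual_dist h h' (d : R) x : pinched e h -> pinched e h' -> S x ->
  (forall u, S u -> `|h u - h' u| <= d) ->
    `|dual h x - dual h' x| <= d / e ^+ 2.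
Proof.
move=> + + Sx; suff H k k' : pinched e k -> pinched e k' ->
    (forall u, S u -> `|k u - k' u| <= d) -> dual k x - dual k' x <= d / e ^+ 2.
  move=> hh hh' hd; rewrite ler_norml H// andbT lerNl opprB H// => u Su.
  by rewrite distrC hd.
move=> hk hk' hd; rewrite lerBlDl; apply: (dual_le e0); first exact: pinched_lb.
move=> u Su; have k0 := pinched_gt0 e0 hk Su; have k'0 := pinched_gt0 e0 hk' Su.
apply: le_trans (lerD (dual_ub e0 (pinched_lb hk') x Su) (lexx _)).
rewrite -lerBlDl -mulrBr; apply: le_trans (ler_norm _) _; rewrite normrM.
apply: le_trans (_ : 1 * `|(k u)^-1 - (k' u)^-1| <= _).
  apply: ler_wpM2r => //;
    rewrite ler_norml dotv_le1// andbT lerNl -dotvNl dotv_le1//.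
  exact: sphereN.
have -> : (k u)^-1 - (k' u)^-1 = (k' u - k u) * ((k u)^-1 * (k' u)^-1).
  by field; rewrite !gt_eqF.
rewrite mul1r normrM distrC; apply: ler_pM => //; first exact: hd.
rewrite ger0_norm ?mulr_ge0 ?invr_ge0 ?(ltW k0) ?(ltW k'0)// expr2 invfM.
by apply: ler_pM; rewrite ?invr_ge0 ?(ltW k0) ?(ltW k'0)// lef_pV2 ?posrE//
  pinched_lb.
Qed.

End Pinched.

End Dual.

(** * Points where a convex function has a kink *)

Section NullSet.
Variable R : realType.

(** Only [C] terms at each end survive the telescoping, so the bound does not grow with the number
    [M] of cells on a grid line. *)
Lemma sum_shift_le (A : nat -> R) (B : R) (M C : nat) :
  (forall j, `|A j| <= B) ->
  \sum_(j < M) (A (j + C)%N - A j) <= 2 * C%:R * B.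
Proof.
move=> AB; elim: C => [|C IH].
  rewrite mulr0 mul0r big1// => j _; by rewrite addn0 subrr.
have -> : \sum_(j < M) (A (j + C.+1)%N - A j) =
  \sum_(j < M) (A (j + C)%N - A j) + (A (M + C)%N - A C).
  rewrite -[A C]/(A (0 + C)%N) -(telescope_sumr (fun j => A (j + C)%N))//.
  rewrite big_mkord -big_split; apply: eq_bigr => j _ /=; rewrite addnS; ring.
have := AB (M + C)%N; have := AB C; rewrite !ler_norml => /andP[? ?] /andP[? ?].
rewrite -natr1; nra.
Qed.

(** A finite cover is padded to a sequence by boxes of volume 0; this bounds its partial sums. *)
Lemma sum_ltn_le (v : R) (b N : nat) : 0 <= v ->
  \sum_(k < N) (if (k < b)%N then v else 0) <= b%:R * v.
Proof.
move=> v0; have -> : \sum_(k < N) (if (k < b)%N then v else 0) =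
  (minn N b)%:R * v.
  elim: N => [|N IH]; first by rewrite big_ord0 min0n mul0r.
  rewrite big_ord_recr /= IH; case: ltnP => Nb.
    by rewrite !(minn_idPl _)// ?ltnW// -natr1 mulrDl mul1r.
  by rewrite addr0 !(minn_idPr _)// ltnW.
by rewrite ler_wpM2r// ler_nat geq_minr.
Qed.

(** The last index [2 * m] accounts for [t = 1], where the truncation reaches the right end. *)
Lemma grid_index (m : nat) (t : R) : (0 < m)%N -> `|t| <= 1 ->
  exists k : 'I_(2 * m).+1, k%:R / m%:R - 1 <= t <= k%:R / m%:R - 1 + m%:R^-1.
Proof.
move=> m0 /ler_normlP[t1 t2]; have mR : 0 < m%:R :> R by rewrite ltr0n.
have T0 : 0 <= (t + 1) * m%:R by rewrite mulr_ge0// ; lra.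
have /andP[k1 k2] := truncn_itv T0; set k := Num.truncn _ in k1 k2.
have kM : (k < (2 * m).+1)%N.
  by rewrite ltnS -(ler_nat R) natrM; apply: (le_trans k1); rewrite ler_pM2r//;
    lra.
exists (Ordinal kM) => /=.
have {}k1 : k%:R / m%:R <= t + 1 by rewrite ler_pdivrMr.
have {}k2 : t + 1 < (k%:R + 1) / m%:R by rewrite ltr_pdivlMr// natr1.
move: k2; rewrite mulrDl mul1r; lra.
Qed.

(* On a grid of mesh [1/m], a cell meeting [A] has second difference at least
   [1/m] in direction [i]; along a grid line the (nonnegative) second
   differences telescope to [O(1/m)], so only boundedly many cells per line
   meet [A]. *)
Lemma second_difference_null (n : nat) (g : 'rV[R]_n.+1 -> R) (L kappa : R)
    (i : 'I_n.+1) (A : set 'rV[R]_n.+1) :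
  0 < L -> 0 < kappa ->
  (forall x y, `|g x - g y| <= L * `|x - y|) ->
  (forall x z, 2 * g x <= g (x + z) + g (x - z)) ->
  (forall x, A x -> `|x| <= 1) ->
  (forall x s, A x -> 0 < s -> kappa * s <=
     g (x + s *: delta_mx ord0 i) + g (x - s *: delta_mx ord0 i) - 2 * g x) ->
  lebesgue_null A.
Proof.
move=> L0 k0 lip cvx A1 Akink eps eps0.
(* Moving the three evaluation points from a kink to the corner of its cell costs at most
   [4 * L * d]. A step of [C] cells makes the kink contribute [kappa * C * d], which exceeds this
   cost by at least [d]. *)
pose C := (Num.truncn ((4 * L + 1) / kappa)).+1.
have CP : 4 * L + 1 <= kappa * C%:R.
  rewrite -ler_pdivrMl// mulrC; apply: ltW; exact: truncnS_gt.
(* The total volume of the bad cells will be at most [(M * d) ^+ n * (2 * C ^+ 2 * L) * d], where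
   [M * d <= 3]; that is [K / m]. *)
pose K := 3 ^+ n * (2 * C%:R ^+ 2 * L).
have K0 : 0 < K by rewrite /K !mulr_gt0// ?exprn_gt0// ltr0n.
pose m := (Num.truncn (K / eps)).+1.
have m0 : (0 < m)%N by [].
have mR : 0 < m%:R :> R by rewrite ltr0n.
have mP : K / m%:R <= eps.
  rewrite ler_pdivrMr// mulrC -ler_pdivrMr//; apply: ltW; exact: truncnS_gt.
pose d : R := m%:R^-1.
have d0 : 0 < d by rewrite invr_gt0.
pose M := (2 * m).+1.
pose E : 'rV[R]_n.+1 := delta_mx ord0 i.
have E1 : `|E| <= 1.
  by apply: norm_rV_le => // j; rewrite mxE eqxx /=; case: eqP;
    rewrite ?normr1 ?normr0.
(* A cell is given by its grid line in direction [i], that is by the other [n] coordinates, and its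
   position on that line. *)
pose P : finType := ({ffun 'I_n -> 'I_M} * 'I_M)%type.
pose idx (p : P) (l : 'I_n.+1) : nat :=
  if unlift i l is Some l' then p.1 l' : nat else p.2 : nat.
pose y (p : P) : 'rV[R]_n.+1 := \row_l ((idx p l)%:R * d - 1).
pose y' (p : P) : 'rV[R]_n.+1 := \row_l ((idx p l)%:R * d - 1 + d).
pose D (p : P) := g (y p + (C%:R * d) *: E) + g (y p - (C%:R * d) *: E) - 2 *
  g (y p).
have D0 p : 0 <= D p by rewrite /D subr_ge0 cvx.
have column c : \sum_(j < M) D (c, j) <= 2 * C%:R * (L * (C%:R * d)).
  pose z : 'rV[R]_n.+1 :=
    \row_l (if unlift i l is Some l' then (c l')%:R * d - 1 else - 1).
  (* The index is shifted by [C] so that the left neighbour at distance [C] also has a natural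
     index; the second difference at [j] is then [A' (j + C) - A' j]. *)
  pose a (j : nat) := g (z + ((j%:R - C%:R) * d) *: E).
  have zE (j : 'I_M) : y (c, j) = z + (j%:R * d) *: E.
    apply/rowP => l; rewrite !mxE /idx eqxx /=.
    case: unliftP => [l' ->|->]; last by rewrite eqxx mulr1 addrC.
    by rewrite eq_sym (negbTE (neq_lift _ _)) mulr0 addr0.
  pose A' j := a (j + C)%N - a j.
  have -> : \sum_(j < M) D (c, j) = \sum_(j < M) (A' (j + C)%N - A' j).
    apply: eq_bigr => j _; rewrite /D /A' /a !zE.
    have -> : z + (j%:R * d) *: E + (C%:R * d) *:
      E = z + (((j + C + C)%:R - C%:R) * d) *: E.
      by rewrite -addrA -scalerDl; congr (_ + _ *: _); rewrite !natrD; ring.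
    have -> : z + (j%:R * d) *: E - (C%:R * d) *: E = z + ((j%:R - C%:R) * d) *:
      E.
      by rewrite -addrA -scalerBl; congr (_ + _ *: _); ring.
    have -> : z + (j%:R * d) *: E = z + (((j + C)%:R - C%:R) * d) *: E.
      by congr (_ + _ *: _); rewrite !natrD; ring.
    ring.
  apply: sum_shift_le => j; apply: (le_trans (lip _ _)); rewrite ler_pM2l//.
  rewrite opprD addrACA subrr add0r -scalerBl normrZ.
  have -> : ((j + C)%:R - C%:R) * d - (j%:R - C%:R) * d = C%:R * d
    by rewrite natrD; ring.
  by rewrite ger0_norm ?mulr_ge0 ?(ltW d0)// ler_piMr// mulr_ge0// ltW.
pose bad := [set p : P | `[< exists2 x, A x & box (y p) (y' p) x >]]%SET.
have badD p : p \in bad -> d <= D p.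
  rewrite inE => /asboolP[x Ax xbox].
  have xy : `|x - y p| <= d.
    apply: norm_rV_le => [|l]; first exact: ltW.
    have := xbox l; rewrite !mxE => /andP[? ?]; rewrite ler_norml; lra.
  have Cd0 : 0 < C%:R * d by rewrite mulr_gt0// ltr0n.
  have := Akink x _ Ax Cd0; rewrite -/E => Hx.
  have e1 : `|g (x + (C%:R * d) *: E) - g (y p + (C%:R * d) *: E)| <= L * d.
    by apply: (le_trans (lip _ _));
      rewrite ler_pM2l// opprD addrACA subrr addr0.
  have e2 : `|g (x - (C%:R * d) *: E) - g (y p - (C%:R * d) *: E)| <= L * d.
    by apply: (le_trans (lip _ _));
      rewrite ler_pM2l// opprD addrACA subrr addr0.
  have e3 : `|g x - g (y p)| <= L * d.
    by apply: (le_trans (lip _ _)); rewrite ler_pM2l.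
  move: e1 e2 e3; rewrite !ler_norml /D => /andP[? ?] /andP[? ?] /andP[? ?].
  have : (4 * L + 1) * d <= kappa * (C%:R * d) by rewrite mulrA ler_pM2r.
  lra.
have cardbad : #|bad|%:R * d <= (M ^ n)%:R * (2 * C%:R * (L * (C%:R * d))).
  apply: (@le_trans _ _ (\sum_(p in bad) D p)).
    rewrite mulr_natl -sumr_const; exact: ler_sum.
  apply: (@le_trans _ _ (\sum_p D p)).
    by rewrite [leRHS](bigID (mem bad)) /= lerDl sumr_ge0.
  rewrite -(pair_bigA _ (fun c j => D (c, j))) /=.
  apply: (@le_trans _ _ (\sum_(c : {ffun 'I_n -> 'I_M}) 2 * C%:R *
    (L * (C%:R * d)))).
    exact: ler_sum.
  by rewrite sumr_const card_ffun !card_ord -[leLHS]mulr_natl.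
have volE (p : P) : box_vol (y p) (y' p) = d ^+ n.+1.
  rewrite /box_vol -[in RHS](card_ord n.+1) -prodr_const.
  by apply: eq_bigr => l _; rewrite !mxE; ring.
pose ak k := if (k < #|bad|)%N then y (nth ([ffun=> ord0], ord0) (enum bad) k)
  else 0.
pose bk k := if (k < #|bad|)%N then y' (nth ([ffun=> ord0], ord0) (enum bad) k)
  else 0.
exists ak, bk; split; [|split].
- move=> k l; rewrite /ak /bk; case: ifP => // _.
  by rewrite !mxE lerDl ltW.
- move=> x Ax; have x1 l : `|x ord0 l| <= 1 by apply: le_trans (A1 _ Ax);
  exact: ler_coord_norm.
  have /choice[f fP] : forall l, exists k :
    'I_M, k%:R * d - 1 <= x ord0 l <= k%:R * d - 1 + d.
    by move=> l; exact: grid_index.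
  pose p : P := ([ffun l' => f (lift i l')], f i).
  have xbox : box (y p) (y' p) x.
    move=> l; rewrite !mxE.
    suff -> : idx p l = f l by exact: fP.
    by rewrite /idx /p /=; case: unliftP => [l' ->|->] //; rewrite ffunE.
  have pbad : p \in bad by rewrite inE; apply/asboolP; exists x.
  have pE : p \in enum bad by rewrite mem_enum.
  exists (index p (enum bad)) => //.
  by rewrite /ak /bk cardE index_mem pE nth_index.
- move=> N; apply: le_trans mP.
  have -> : \sum_(k < N) box_vol (ak k) (bk k) =
      \sum_(k < N) (if (k < #|bad|)%N then d ^+ n.+1 else 0).
    apply: eq_bigr => k _; rewrite /ak /bk; case: ifP => _; first exact: volE.
    by rewrite /box_vol big_ord_recl !mxE subrr mul0r.
  apply: (le_trans (sum_ltn_le _ _ _)); first by rewrite exprn_ge0// ltW.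
  rewrite exprS mulrA.
  apply: (@le_trans _ _ ((M ^ n)%:R * (2 * C%:R * (L * (C%:R * d))) * d ^+ n)).
    by rewrite ler_wpM2r// exprn_ge0// ltW.
  rewrite natrX.
  have -> : M%:R ^+ n * (2 * C%:R * (L * (C%:R * d))) * d ^+ n =
      (M%:R * d) ^+ n * (2 * C%:R ^+ 2 * L) * d by rewrite exprMn; ring.
  rewrite /K -/d ler_pM2r// ler_pM2r ?mulr_gt0 ?exprn_gt0 ?ltr0n//.
  have Md : M%:R * d <= 3.
    rewrite /d ler_pdivrMr// -natrM ler_nat /M; lia.
  by rewrite lerXn2r// nnegrE// mulr_ge0// ltW.
Qed.

End NullSet.

Section PolarPair.
Variables (R : realType) (n : nat).
Local Notation V := 'rV[R]_n.+1.
Local Notation S := (@sphere R n.+1).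

(* On the sphere [h] is the support function of the body [{x | g x <= 1}] and
   [g] the reciprocal of its radial function. *)
Definition polar_pair (e : R) (h g : V -> R) : Prop :=
  [/\ pinched e h, h = dual g & g = dual h].

(* The outer unit normals at the boundary point in direction [x]. *)
Definition contact (h g : V -> R) (x : V) : set V :=
  [set u | S u /\ dotv u x = g x * h u].

(* [u / h u] is a subgradient of [g] at [x] when [u] is a contact direction,
   so these are the points of the sphere where [g] has a kink of size at least
   [1 / k.+1] in direction [i]. *)
Definition kink (h g : V -> R) (i : 'I_n.+1) (k : nat) : set V :=
  [set x | S x /\ exists u1 u2, [/\ contact h g x u1, contact h g x u2 &
     k.+1%:R^-1 <= u2 ord0 i / h u2 - u1 ord0 i / h u1]].

Lemma polar_pair_sym e h g : 0 < e -> polar_pair e h g -> polar_pair e g h.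
Proof. by move=> e0 [ph hE gE]; split=> //; rewrite gE; exact: pinched_dual.
  Qed.

(** The gauge is a triple dual because [dual3] identifies it with [dual h] on the sphere only. As
    [dual] reads its argument on the sphere alone, one more application turns this into equality of
    functions. *)
Lemma polar_pair_dual e h : 0 < e -> pinched e h ->
  polar_pair e (dual (dual h)) (dual (dual (dual h))).
Proof.
move=> e0 ph; split => //; first by do 2 apply: pinched_dual => //.
by apply: eq_dual => u Su; rewrite (dual3 e0 ph).
Qed.

Section Facts.
Variables (e : R) (h g : V -> R).
Hypotheses (e0 : 0 < e) (hg : polar_pair e h g).

Lemma polar_pinched : pinched e h. Proof. by case: hg. Qed.

Lemma polar_pinched_g : pinched e g.
Proof. by case: (polar_pair_sym e0 hg). Qed.

Lemma polar_gt0 u : S u -> 0 < h u.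
Proof. exact: (pinched_gt0 e0 polar_pinched). Qed.

Lemma polar_gt0_g u : S u -> 0 < g u.
Proof. exact: (pinched_gt0 e0 polar_pinched_g). Qed.

Let hlb := pinched_lb polar_pinched.

Lemma polar_continuous_g : continuous g.
Proof. case: hg => _ _ gE; rewrite [in X in continuous X]gE;
  exact: (dual_continuous e0 hlb). Qed.

Lemma polar_ineq u x : S u -> dotv u x <= g x * h u.
Proof. case: hg => _ _ gE Su; rewrite [in X in _ <= X]gE;
  exact: (dual_ubM e0 hlb). Qed.

Lemma polarZ_g t x : 0 <= t -> g (t *: x) = t * g x.
Proof. case: hg => _ _ gE t0; rewrite {1}gE [in RHS]gE; exact: (dualZ e0 hlb).
  Qed.

Lemma polarD_g x y : g (x + y) <= g x + g y.
Proof. case: hg => _ _ gE; rewrite [in X in X <= _]gE [in X in _ <= X]gE;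
  exact: (dualD e0 hlb). Qed.

Lemma polar_lip_g x y : `|g x - g y| <= n.+1%:R / e * `|x - y|.
Proof. case: hg => _ _ gE; rewrite [in X in X <= _]gE; exact: (dual_lip e0 hlb).
  Qed.

Lemma polar_le_g x c : (forall u, S u -> dotv u x / h u <= c) -> g x <= c.
Proof. case: hg => _ _ gE H; rewrite gE; exact: (dual_le e0 hlb). Qed.

End Facts.

Section Facts2.
Variables (e : R) (h g : V -> R).
Hypotheses (e0 : 0 < e) (hg : polar_pair e h g).
Let gh := polar_pair_sym e0 hg.

Lemma polar_continuous : continuous h.
Proof. exact: polar_continuous_g e0 gh. Qed.

Lemma polar_ratio_continuous x :
  {within S, continuous (fun u => dotv u x / h u)}.
Proof.
apply: continuous_in_subspaceT => u /set_mem Su; apply: (@cvgM _ _ (nbhs u)).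
  exact: continuous_dotvl.
apply: (@cvgV _ _ (nbhs u)); first by rewrite gt_eqF// (polar_gt0 e0 hg).
exact: polar_continuous.
Qed.

(** The supremum defining the gauge is attained, the sphere being compact. *)
Lemma contact_nonempty x : contact h g x !=set0.
Proof.
have [u uS umax] := EVT_max_rV (sphere_nonempty R n) (@compact_sphere R n.+1)
  (@polar_ratio_continuous x).
have Su := set_mem uS; exists u; split => //.
apply/eqP; rewrite eq_le (polar_ineq e0 hg)//=.
rewrite -ler_pdivlMr ?(polar_gt0 e0 hg)//; apply: (polar_le_g e0 hg) => v Sv.
exact: umax (mem_set Sv).
Qed.

Lemma contact_subgradient x u y : contact h g x u ->
  g x + dotv u y / h u <= g (x + y).
Proof.
move=> [Su ux]; have h0 := polar_gt0 e0 hg Su.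
have -> : g x = dotv u x / h u by rewrite ux mulfK// gt_eqF.
by rewrite -mulrDl -dotvDr ler_pdivrMr// (polar_ineq e0 hg).
Qed.

Lemma closed_eq_fun (T : topologicalType) (f1 f2 : T -> R) :
  continuous f1 -> continuous f2 -> closed [set x | f1 x = f2 x].
Proof.
move=> c1 c2; have -> :
  [set x | f1 x = f2 x] = (fun x => f1 x - f2 x) @^-1` [set 0].
  by apply/seteqP; split => x /= => [->|/eqP];
    rewrite ?subrr// subr_eq0 => /eqP.
apply: preimage_closed; last exact: closed_eq.
by move=> x _; apply: cvgB; [exact: c1|exact: c2].
Qed.

Lemma closed_le_fun (T : topologicalType) (f1 f2 : T -> R) :
  continuous f1 -> continuous f2 -> closed [set x | f1 x <= f2 x].
Proof.
move=> c1 c2; have -> :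
  [set x | f1 x <= f2 x] = (fun x => f2 x - f1 x) @^-1` [set y | 0 <= y].
  by apply/seteqP; split => x /=; rewrite subr_ge0.
apply: preimage_closed; last exact: closed_ge.
by move=> x _; apply: cvgB; [exact: c2|exact: c1].
Qed.

(* Positive denominators are cleared so that the condition is closed on the
   whole space. *)
Lemma closed_kink i k : closed (kink h g i k).
Proof.
pose X : set (V * (V * V)) :=
  [set p | S p.1] `&` ([set p | S p.2.1] `&` [set p | S p.2.2]).
have cX : compact X.
  rewrite (_ : X = S `*` (S `*` S)); last by apply/seteqP; split.
  have cS := @compact_sphere R n.+1;
    exact: (compact_setX cS (compact_setX cS cS)).
pose Y : set (V * (V * V)) := [set p | dotv p.2.1 p.1 = g p.1 * h p.2.1] `&`
  ([set p | dotv p.2.2 p.1 = g p.1 * h p.2.2] `&`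
   [set p | k.+1%:R^-1 * (h p.2.1 * h p.2.2) <=
        p.2.2 ord0 i * h p.2.1 - p.2.1 ord0 i * h p.2.2]).
have cg := polar_continuous_g e0 hg; have ch := polar_continuous.
have c1 : continuous (fun p : V * (V * V) => p.1) by move=> p; exact: cvg_fst.
have c2 : continuous (fun p : V * (V * V) => p.2.1).
  by move=> p; apply: (@continuous_comp _ _ _ snd fst);
    [exact: cvg_snd|exact: cvg_fst].
have c3 : continuous (fun p : V * (V * V) => p.2.2).
  by move=> p; apply: (@continuous_comp _ _ _ snd snd);
    [exact: cvg_snd|exact: cvg_snd].
have comp (f : V -> R) (q : V * (V * V) -> V) : continuous f -> continuous q ->
    continuous (fun p => f (q p)).
  by move=> cf cq p; apply: (@continuous_comp _ _ _ q f); [exact: cq|exact: cf].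
have cM (f1 f2 : V * (V * V) -> R) : continuous f1 -> continuous f2 ->
    continuous (fun p => f1 p * f2 p).
  by move=> d1 d2 p; apply: (@cvgM _ _ (nbhs p)); [exact: d1|exact: d2].
have cB (f1 f2 : V * (V * V) -> R) : continuous f1 -> continuous f2 ->
    continuous (fun p => f1 p - f2 p).
  by move=> d1 d2 p; apply: (@cvgB _ _ _ (nbhs p)); [exact: d1|exact: d2].
have cY : closed Y.
  apply: closedI; [|apply: closedI].
  - by apply: closed_eq_fun; [exact: continuous_dotv|apply: cM; exact: comp].
  - by apply: closed_eq_fun; [exact: continuous_dotv|apply: cM; exact: comp].
  - apply: closed_le_fun.
      apply: (cM (cst _)); first by exact: cst_continuous.
      by apply: cM; exact: comp.
    apply: cB.
      by apply: (cM (fun p => p.2.2 ord0 i));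
        [apply: (comp (fun x => x ord0 i)) => //;
        exact: coord_continuous|exact: comp].
    by apply: (cM (fun p => p.2.1 ord0 i));
      [apply: (comp (fun x => x ord0 i)) => //;
      exact: coord_continuous|exact: comp].
have cXY : compact (X `&` Y) by exact: compact_closedI.
(* The existential quantifiers over the two contact directions amount to projecting a compact
   set. *)
have -> : kink h g i k = fst @` (X `&` Y).
  apply/seteqP; split => [x [Sx [u1 [u2 [[S1 e1] [S2 e2] H]]]]|_
    [[x [u1 u2]] [[/= Sx [S1 S2]] [e1 [e2 H]]] <-]].
    exists (x, (u1, u2)) => //; split; split => //; split => //=.
    have h1 := polar_gt0 e0 hg S1; have h2 := polar_gt0 e0 hg S2.
    rewrite -ler_pdivlMr ?mulr_gt0//; apply: (le_trans H).
    by rewrite le_eqVlt; apply/orP; left; apply/eqP; field; rewrite !gt_eqF.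
  split => //; exists u1, u2; split => //.
  have h1 := polar_gt0 e0 hg S1; have h2 := polar_gt0 e0 hg S2.
  move: H => /=; rewrite -ler_pdivlMr ?mulr_gt0// => /le_trans; apply.
  by rewrite le_eqVlt; apply/orP; left; apply/eqP; field; rewrite !gt_eqF.
apply: compact_closed; first exact: norm_hausdorff.
apply: continuous_compact => //; apply: continuous_subspaceT; exact: c1.
Qed.

(** By homogeneity of the gauge, contact directions are constant along rays, so the whole cone
    consists of kinks. The subgradient inequality of [u2] for the step [s] in direction [i] plus
    that of [u1] for the step [- s] bounds the second difference below by [s / k.+1]. *)
Lemma spherical_null_kink i k : spherical_null (kink h g i k).
Proof.
have L0 : 0 < n.+1%:R / e by rewrite divr_gt0.
have k0 : 0 < k.+1%:R^-1 :> R by rewrite invr_gt0.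
apply: (@second_difference_null R n g _ _ i _ L0 k0).
- exact: polar_lip_g e0 hg.
- move=> x z; have := polarD_g e0 hg (x + z) (x - z).
  by rewrite addrACA subrr addr0 -mulr2n -scaler_nat (polarZ_g e0 hg).
- move=> _ [x [t [_ [Sx [t0 [t1 ->]]]]]].
  by rewrite normrZ gtr0_norm//; apply: mulr_ile1 => //;
    [exact: ltW|exact: sphere_norm].
move=> _ s [x [t [[_ [u1 [u2 [c1 c2 H]]]] [Sx [t0 [t1 ->]]]]]] s0.
have cZ u : contact h g x u -> contact h g (t *: x) u.
  by move=> [Su E]; split => //; rewrite dotvZr E (polarZ_g e0 hg) ?ltW// mulrA.
have dE (u : V) : dotv u (delta_mx ord0 i) = u ord0 i.
  rewrite /dotv (bigD1 i)//= mxE !eqxx mulr1 big1 ?addr0// => j /negbTE ji.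
  by rewrite mxE ji andbF mulr0.
have := contact_subgradient (s *: delta_mx ord0 i) (cZ _ c2).
have := contact_subgradient (- (s *: delta_mx ord0 i)) (cZ _ c1).
rewrite dotvNr !dotvZr !dE mulNr -!(mulrA s) => H1 H2.
have := ler_wpM2l (ltW s0) H; rewrite mulrBr [s / _]mulrC.
move: H1 H2; set a := g (_ - _); set b := g (_ + _); set c := g _.
set p := s * _; set q := s * _; set r := _ * s; lra.
Qed.

(** A positive gap between coordinates of [u / h u] for two contact directions would make [x] a kink
    for large [k]. Hence these vectors agree, [u1] is a positive multiple of [u2], and both have
    unit length. *)
Lemma contact_unique x u1 u2 : S x -> (forall i k, ~ kink h g i k x) ->
  contact h g x u1 -> contact h g x u2 -> u1 = u2.
Proof.
move=> Sx nk; suff coord v1 v2 i : contact h g x v1 -> contact h g x v2 ->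
    v2 ord0 i / h v2 <= v1 ord0 i / h v1.
  move=> c1 c2; have h1 := polar_gt0 e0 hg c1.1;
    have h2 := polar_gt0 e0 hg c2.1.
  have E : (h u1)^-1 *: u1 = (h u2)^-1 *: u2.
    apply/rowP => i; rewrite !mxE ![_^-1 * _]mulrC.
    by apply/eqP; rewrite eq_le !coord.
  have E2 : u1 = (h u1 / h u2) *: u2.
    by rewrite -scalerA -E scalerA mulfV ?scale1r// gt_eqF.
  have : (h u1 / h u2) ^+ 2 = 1.
    have := c1.1; rewrite /sphere /=
      {1 2}E2 dotvZl dotvZr (c2.1 : dotv u2 u2 = 1) mulr1.
    by rewrite expr2.
  move/eqP; rewrite sqrp_eq1 ?divr_ge0 ?ltW// => /eqP r1.
  by rewrite E2 r1 scale1r.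
move=> c1 c2; rewrite leNgt; apply/negP; rewrite -subr_gt0 => d0.
set d := (X in 0 < X) in d0.
apply: (nk i (Num.truncn d^-1)); split => //; exists v1, v2; split => //.
rewrite -/d -[leRHS]invrK lef_pV2 ?posrE ?invr_gt0//; apply: ltW.
exact: truncnS_gt.
Qed.

End Facts2.

End PolarPair.

(** * Integration on the sphere *)

Section BoundedMeasurable.
Context d (T : measurableType d) (R : realType).
Variables (mu : {measure set T -> \bar R}) (D : set T).
Hypotheses (mD : measurable D) (muD : (mu D < +oo)%E).
Implicit Types f g : T -> R.

(** Unlike integrability, this condition is stable under products, and on a set of finite measure it
    implies integrability. *)
Definition bounded_measurable f : Prop :=
  measurable_fun D f /\ exists M, forall x, D x -> `|f x| <= M.

Lemma bm_integrable f : bounded_measurable f -> mu.-integrable D (EFin \o f).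
Proof.
move=> [mf [M fM]]; apply: measurable_bounded_integrable => //.
by exists M; split; [exact: num_real|move=> K MK x Dx;
  exact: le_trans (fM _ Dx) (ltW MK)].
Qed.

Lemma bm_cst c : bounded_measurable (fun=> c).
Proof. by split; [exact: measurable_cst|exists `|c|]. Qed.

Lemma bmD f g : bounded_measurable f -> bounded_measurable g ->
  bounded_measurable (fun x => f x + g x).
Proof.
move=> [mf [M fM]] [mg [N gN]]; split; first exact: measurable_funD.
by exists (M + N) => x Dx; rewrite (le_trans (ler_normD _ _))// lerD ?fM ?gN.
Qed.

Lemma bmM f g : bounded_measurable f -> bounded_measurable g ->
  bounded_measurable (fun x => f x * g x).
Proof.
move=> [mf [M fM]] [mg [N gN]]; split; first exact: measurable_funM.
by exists (M * N) => x Dx; rewrite normrM ler_pM ?fM ?gN.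
Qed.

Lemma bmB f g : bounded_measurable f -> bounded_measurable g ->
  bounded_measurable (fun x => f x - g x).
Proof.
move=> bf bg; have := bmD bf (bmM (bm_cst (-1)) bg).
by under eq_fun do rewrite mulN1r.
Qed.

Local Notation J f := (\int[mu]_(x in D) f x).

Lemma bm_integralD f g : bounded_measurable f -> bounded_measurable g ->
  J (fun x => f x + g x) = J f + J g.
Proof. by move=> bf bg; apply: RintegralD => //; exact: bm_integrable. Qed.

Lemma bm_integralB f g : bounded_measurable f -> bounded_measurable g ->
  J (fun x => f x - g x) = J f - J g.
Proof. by move=> bf bg; apply: RintegralB => //; exact: bm_integrable. Qed.

Lemma bm_integralZl c f : bounded_measurable f ->
  J (fun x => c * f x) = c * J f.
Proof. by move=> bf; apply: RintegralZl => //; exact: bm_integrable. Qed.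

Lemma bm_le_integral f g : bounded_measurable f -> bounded_measurable g ->
  (forall x, D x -> f x <= g x) -> J f <= J g.
Proof. by move=> bf bg; apply: le_Rintegral => //; exact: bm_integrable. Qed.

Lemma eq_integral_on f g : (forall x, D x -> f x = g x) -> J f = J g.
Proof. by move=> fg; apply: eq_Rintegral => x /set_mem; exact: fg. Qed.

Lemma bm_integral_cst c : J (fun=> c) = c * fine (mu D).
Proof. exact: Rintegral_cst. Qed.

Lemma bm_integral_dist f g c : bounded_measurable f -> bounded_measurable g ->
  (forall x, D x -> `|f x - g x| <= c) -> `|J f - J g| <= c * fine (mu D).
Proof.
move=> bf bg fg; rewrite -bm_integralB// ler_norml -mulNr -!bm_integral_cst.
apply/andP; split; apply: bm_le_integral; do ?[exact: bm_cst|exact: bmB].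
- by move=> x /fg; rewrite ler_norml => /andP[].
- by move=> x /fg; rewrite ler_norml => /andP[].
Qed.

Lemma bm_integral_cvg (f_ : nat -> T -> R) f (M : R) (N : set T) :
  measurable N -> mu N = 0%E ->
  (forall k, measurable_fun D (f_ k)) -> bounded_measurable f ->
  (forall k x, D x -> `|f_ k x| <= M) ->
  (forall x, D x -> ~ N x -> f_ ^~ x @ \oo --> f x) ->
  (fun k => J (f_ k)) @ \oo --> J f.
Proof.
move=> mN N0 mf bf fM cf.
have [] := @dominated_convergence _ _ _ mu D mD (fun k => EFin \o f_ k)
  (EFin \o f) (EFin \o cst M).
- by move=> k; exact/measurable_EFinP.
- by apply/measurable_EFinP; case: bf.
- exists N; split => // x /= /not_implyP[Dx nc]; apply: contrapT => nN;
  apply: nc.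
  by apply: cvg_EFin; [exact: nearW|exact: cf].
- by apply: bm_integrable; exact: bm_cst.
- by apply: aeW => x k Dx; rewrite /= lee_fin fM.
move=> intf _ c; apply: fine_cvg; rewrite fineK//.
exact: integrable_fin_num.
Qed.

Lemma bm_integral_gt0 f : (0 < mu D)%E -> bounded_measurable f ->
  (forall x, D x -> 0 < f x) -> 0 < J f.
Proof.
move=> m0 [mf bf] f0; rewrite lt_neqAle eq_sym Rintegral_ge0 ?andbT; last first.
  by move=> x Dx; exact/ltW/f0.
apply/eqP => Jf0.
have fin := integrable_fin_num mD (bm_integrable (conj mf bf)).
have : (\int[mu]_(x in D) (f x)%:E = 0)%E
  by rewrite -[LHS]fineK// -/(Rintegral _ _ _) [Rintegral _ _ _]Jf0.
have mEf : measurable_fun D (EFin \o f) by exact/measurable_EFinP.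
have -> : (\int[mu]_(x in D) (f x)%:E = \int[mu]_(x in D) `|(EFin \o f) x|)%E.
  by apply: eq_integral => x /set_mem Dx; rewrite /= gtr0_norm// f0.
move=> /(ae_eq_integral_abs mu mD mEf)[N [mN N0 sub]].
have DN : D `<=` N.
  by move=> x Dx; apply: sub => /= /(_ Dx) /eqP; rewrite eqe gt_eqF// f0.
by move: m0; rewrite ltNge -N0 le_measure// inE.
Qed.

End BoundedMeasurable.

Section SphereIntegral.
Variables (R : realType) (n : nat).
Local Notation V := 'rV[R]_n.
Local Notation B := (Borel R n).
Local Notation S := (@sphere R n).

Lemma measurable_open (A : set V) : open A -> measurable (A : set B).
Proof. by move=> oA; exact: sub_sigma_algebra. Qed.

Lemma measurable_closed (A : set V) : closed A -> measurable (A : set B).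
Proof.
by move=> cA; rewrite -(setCK A); apply: measurableC; apply: measurable_open;
  exact: closed_openC.
Qed.

Lemma measurable_sphere : measurable (S : set B).
Proof. apply: measurable_closed; exact: closed_sphere. Qed.

Lemma measurable_within_continuous (A : set V) (f : V -> R) : closed A ->
  {within A, continuous f} -> measurable_fun (A : set B) (f : B -> R).
Proof.
move=> cA /continuousP cf; apply: (measurability _ (RGenOpens.measurableE R)).
move=> _ [_ [a [b ->] <-]].
have oI : open `]a, b[%classic by exact: interval_open.
have /open_subspaceP [U oU UA] := cf _ oI.
by rewrite setIC -UA; apply: measurableI;
  [exact: measurable_open|exact: measurable_closed].
Qed.

Lemma bm_continuous (f : V -> R) : {within S, continuous f} ->
  bounded_measurable (S : set B) (f : B -> R).
Proof.
move=> cf; split; first by apply: measurable_within_continuous => //;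
  exact: closed_sphere.
have /compact_bounded[M [_ fM]] := continuous_compact cf (@compact_sphere R n).
exists (M + 1) => x Sx; apply: (fM (M + 1)); first by rewrite ltrDl.
by exists x.
Qed.

End SphereIntegral.

Section Nemytskii.
Variables (R : realType) (n : nat).
Local Notation V := 'rV[R]_n.
Local Notation B := (Borel R n).
Local Notation S := (@sphere R n).
Local Notation D := (@dom_St R n).

Lemma within_comp (H : V * R -> R) (w : V -> R) :
  {within D, continuous H} -> {within S, continuous w} ->
  (forall u, S u -> 0 < w u) -> {within S, continuous (fun u => H (u, w u))}.
Proof.
move=> /subspace_continuousP cH /subspace_continuousP cw w0.
apply/subspace_continuousP => u Su.
have Du : D (u, w u) by split => //=; exact: w0.
move=> W nW; have [[A1 A2] /= [n1 n2] sub] := cH _ Du W nW.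
have n3 : nbhs u [set x | S x -> A2 (w x)] := cw u Su A2 n2.
apply: filterS (filterI n1 n3) => x [A1x A2x] Sx.
by apply: (sub (x, w x)); split => //=; [exact: A2x|exact: w0].
Qed.

Section C1.
Variable F : V -> R -> R.
Hypothesis FC : in_C F.

Lemma within_comp_F (w : V -> R) : {within S, continuous w} ->
  (forall u, S u -> 0 < w u) -> {within S, continuous (fun u => F u (w u))}.
Proof. by case: FC => _ [cF _]; exact: (within_comp cF). Qed.

Lemma within_comp_dt (w : V -> R) : {within S, continuous w} ->
  (forall u, S u -> 0 < w u) -> {within S, continuous (fun u => dt F u (w u))}.
Proof. by case: FC => _ [_ cF]; exact: (within_comp cF). Qed.

Lemma compact_band (e : R) : compact (S `*` [set` `[e, e^-1]] : set (V * R)).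
Proof. by apply: compact_setX; [exact: compact_sphere|exact: segment_compact].
  Qed.

Lemma dt_bounded (e : R) : 0 < e -> exists L, 0 < L /\
  forall u (s : R), S u -> e <= s <= e^-1 -> `|dt F u s| <= L.
Proof.
move=> e0; case: FC => _ [_ cF].
have sub : (S `*` [set` `[e, e^-1]] : set (V * R)) `<=` D.
  by move=> [u s] [/= Su]; rewrite in_itv /= => /andP[es _]; split => //=;
    exact: lt_le_trans es.
have /compact_bounded[M [_ fM]] :=
  continuous_compact (continuous_subspaceW sub cF) (@compact_band e).
exists (`|M| + 1); split; first by rewrite ltr_wpDl.
move=> u s Su es; apply: (fM (`|M| + 1)); first by rewrite ltr_pwDr// ler_norm.
by exists (u, s) => //; split => //=; rewrite in_itv.
Qed.

Lemma C_is_derive u (s : R) : S u -> 0 < s -> is_derive s 1 (F u) (dt F u s).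
Proof.
move=> Su s0; case: FC => dF _; have df := dF u s Su s0.
by rewrite /dt derive1E; apply/derivableP.
Qed.

Lemma C_mvt u (a b : R) : S u -> 0 < a -> a <= b ->
  exists2 c, a <= c <= b & F u b - F u a = dt F u c * (b - a).
Proof.
move=> Su a0 ab.
have der (x : R) : a <= x -> is_derive x 1 (F u) (dt F u x).
  by move=> ax; apply: C_is_derive => //; exact: lt_le_trans ax.
have d1 x : x \in `]a, b[ -> is_derive x 1 (F u) (dt F u x).
  by rewrite in_itv /= => /andP[ax _]; apply: der; exact: ltW.
have cF : {within `[a, b], continuous (F u)}.
  apply: derivable_within_continuous => x; rewrite in_itv /= => /andP[ax _].
  by have := der x ax; case.
have [c] := @MVT_segment R (F u) (dt F u) a b ab d1 cF.
by rewrite in_itv /= => cab E; exists c.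
Qed.

Lemma C_lip (e L : R) u (s s' : R) : 0 < e ->
  (forall u (s : R), S u -> e <= s <= e^-1 -> `|dt F u s| <= L) ->
  S u -> e <= s <= e^-1 -> e <= s' <= e^-1 ->
    `|F u s - F u s'| <= L * `|s - s'|.
Proof.
move=> e0 HL Su; wlog ss : s s' / s' <= s.
  move=> W hs hs'; have [le|/ltW le] := leP s' s; first exact: W.
  by rewrite distrC (distrC s) W.
move=> /andP[s1 s2] /andP[s1' s2'].
have [c /andP[c1 c2] ->] := C_mvt Su (lt_le_trans e0 s1') ss.
by rewrite normrM ler_wpM2r// HL// (le_trans s1' c1) (le_trans c2 s2).
Qed.

Lemma C_taylor u (s eta : R) : S u -> 0 < s -> 0 < eta ->
  exists2 del, 0 < del & forall s', `|s' - s| < del ->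
    `|F u s' - F u s - dt F u s * (s' - s)| <= eta * `|s' - s|.
Proof.
move=> Su s0 eta0; have [df dE] := C_is_derive Su s0.
move: df; rewrite /derivable => df.
have := df; rewrite -/(derive (F u) s 1) in dE.
move=> /cvg_ex[l Hl].
have lE : l = dt F u s by rewrite -dE /derive; apply/esym; exact: cvg_lim Hl.
rewrite lE in Hl.
move/cvgrPdist_le : Hl => /(_ _ eta0).
move=> [del /= del0 Hdel]; exists del => // s' s's.
have [->|ne] := eqVneq s' s; first by rewrite !subrr mulr0 subr0 normr0 mulr0.
have h0 : s' - s != 0 by rewrite subr_eq0.
have := Hdel (s' - s); rewrite /= sub0r normrN => /(_ s's h0).
rewrite -[_ *: 1]/(_ * 1) mulr1 subrK -[_ *: _]/(_ * _) => H.
have -> : F u s' - F u s - dt F u s * (s' - s) =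
   - ((dt F u s - (s' - s)^-1 * (F u s' - F u s)) * (s' - s)) by field.
by rewrite normrN normrM ler_wpM2r.
Qed.

(** A chain rule along sequences: for the gauge, only convergence of difference quotients along [t_]
    will be available. *)
Lemma C_chain u (s : R) (w_ t_ : nat -> R) (z : R) : S u -> 0 < s ->
  (forall k, 0 < t_ k) -> t_ @ \oo --> 0 ->
  (fun k => (w_ k - s) / t_ k) @ \oo --> z ->
  (fun k => (F u (w_ k) - F u s) / t_ k) @ \oo --> dt F u s * z.
Proof.
move=> Su s0 t0 ct cz.
have cw : (fun k => w_ k - s) @ \oo --> 0.
  rewrite (_ : (fun k => _) = (fun k => (w_ k - s) / t_ k * t_ k)); last first.
    by apply/funext => k; rewrite divfK// gt_eqF.
  by rewrite -[0](mulr0 z); apply: cvgM.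
have r0 : (fun k => (F u (w_ k) - F u s - dt F u s * (w_ k - s)) / t_ k)
  @ \oo --> 0.
  apply/cvgr0Pnorm_le => eps eps0.
  have z1 : 0 < `|z| + 1 by rewrite ltr_wpDl.
  have [del del0 Hdel] := C_taylor Su s0 (divr_gt0 eps0 z1).
  have n1 : \forall k \near \oo, `|w_ k - s| < del by apply: cvgr0_norm_lt.
  have n2 : \forall k \near \oo, `|(w_ k - s) / t_ k| <= `|z| + 1.
    by apply: (cvgr_norm_le _ cz); rewrite ltrDl.
  near=> k; have /Hdel H : `|w_ k - s| < del by near: k; exact: n1.
  rewrite normrM normfV (gtr0_norm (t0 k)) ler_pdivrMr//.
  apply: le_trans H _; rewrite -mulrA ler_pM2l// ler_pdivrMl//.
  have : `|(w_ k - s) / t_ k| <= `|z| + 1 by near: k; exact: n2.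
  by rewrite normrM normfV (gtr0_norm (t0 k)) ler_pdivrMr.
rewrite (_ : (fun k => _) =
  (fun k => (F u (w_ k) - F u s - dt F u s * (w_ k - s)) / t_ k
   + dt F u s * ((w_ k - s) / t_ k))); last first.
  by apply/funext => k; rewrite mulrA -mulrDl subrK.
rewrite -[_ * z]add0r; apply: cvgD => //; apply: cvgM => //; exact: cvg_cst.
Unshelve. all: by end_near. Qed.

End C1.
End Nemytskii.

(** * Coercivity of integral functionals over non-concentrated measures *)

Section Coercivity.
Variables (R : realType) (n : nat).
Local Notation V := 'rV[R]_n.
Local Notation B := (Borel R n).
Local Notation S := (@sphere R n).

Lemma CI_le (F : V -> R -> R) u (s t : R) : in_CI F -> S u -> 0 < s -> s <= t ->
  F u s <= F u t.
Proof.
move=> [FC F0] Su s0 st; rewrite -subr_ge0.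
have [c /andP[sc ct] ->] := C_mvt FC Su s0 st.
by rewrite mulr_ge0 ?subr_ge0// ltW// F0//; exact: lt_le_trans sc.
Qed.

Lemma CI_bm (F : V -> R -> R) (w : V -> R) : in_C F ->
  {within S, continuous w} -> (forall u, S u -> 0 < w u) ->
  bounded_measurable (S : set B) (fun u : B => F u (w u)).
Proof. by move=> FC cw w0; apply: bm_continuous; exact: within_comp_F. Qed.

Variables (m : {measure set B -> \bar R}).

Definition pos_cap (u : V) : set V := [set x | S x /\ 0 < dotv u x].

Lemma measurable_halfspace (u : V) :
  measurable ([set x | 0 < dotv u x] : set B).
Proof.
apply: measurable_open;
  rewrite (_ : [set x : V | 0 < dotv u x] = (fun x => dotv u x) @^-1`
  [set y | 0 < y])//.
by apply: open_comp; [move=> x _; exact: continuous_dotvr|exact: open_gt].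
Qed.

Lemma measurable_pos_cap (u : V) : measurable (pos_cap u : set B).
Proof. by apply: measurableI;
  [exact: measurable_sphere|exact: measurable_halfspace]. Qed.

Lemma measurable_cap (u : V) (d : R) :
  measurable ([set x | S x /\ d <= dotv u x] : set B).
Proof.
apply: measurable_closed.
rewrite (_ : [set x | _] = S `&` (fun x => dotv u x) @^-1` [set y | d <= y])//.
apply: closedI; first exact: closed_sphere.
by apply: preimage_closed;
  [move=> x _; exact: continuous_dotvr|exact: closed_ge].
Qed.

(** The integrand is positive exactly on the open hemisphere around [u], so non-concentration means
    that every open hemisphere has positive mass. *)
Lemma integral_pos_part_gt0 (u : V) :
  (0 < \int[m]_(x in (S : set B)) (Num.max (dotv u x) 0)%:E)%E <->
  (0 < m (pos_cap u))%E.
Proof.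
pose f (x : B) : \bar R := (Num.max (dotv u x) 0)%:E.
have mS := @measurable_sphere R n.
have mf : measurable_fun (S : set B) f.
  apply/measurable_EFinP; apply: measurable_maxr; last exact: measurable_cst.
  apply: measurable_within_continuous; first exact: closed_sphere.
  apply: continuous_subspaceT; exact: continuous_dotvr.
have f0 x : (0 <= f x)%E by rewrite lee_fin le_max lexx orbT.
suff E : (\int[m]_(x in (S : set B)) f x = 0)%E <-> (m (pos_cap u) = 0)%E.
  have pos (a : \bar R) : (0 <= a)%E -> (0 < a)%E <-> a <> 0%E.
    by move=> a0; rewrite lt_neqAle a0 andbT eq_sym; split => [/eqP|/eqP].
  rewrite !pos ?measure_ge0//; last by apply: integral_ge0 => x _; exact: f0.
  by split => H /E.
have -> : (\int[m]_(x in (S : set B)) f x = \int[m]_(x in (S : set B)) `|f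
  x|)%E.
  by apply: eq_integral => x _; rewrite gee0_abs.
rewrite (ae_eq_integral_abs m mS mf).
have pc x : pos_cap u x <-> ~ (S x -> f x = cst 0%E x).
  split => [[Sx ux] H|/not_implyP[Sx H]].
    by have := H Sx; rewrite /f /= => -[] /eqP;
      rewrite max_l ?(ltW ux)// gt_eqF.
  split => //; rewrite ltNge; apply/negP => ux; apply: H.
  by rewrite /f max_r.
split => [[N [mN N0 sub]]|H].
  apply/eqP; rewrite eq_le measure_ge0 andbT -N0 le_measure ?inE//.
    exact: measurable_pos_cap.
  by move=> x /pc; exact: sub.
exists (pos_cap u); split => //; first exact: measurable_pos_cap.
by move=> x /pc.
Qed.

(** The open hemisphere is a countable union of the closed caps of height [k.+1%:R^-1]. *)
Lemma cap_measure_gt0 (u : V) : (0 < m (pos_cap u))%E ->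
  exists2 d : R, 0 < d & (0 < m [set x | S x /\ (d <= dotv u x)%R])%E.
Proof.
pose A k : set B := [set x | S x /\ k.+1%:R^-1 <= dotv u x].
have mA k : measurable (A k) by exact: measurable_cap.
move=> H; apply: contrapT => nd.
have A0 k : m (A k) = 0%E.
  apply/eqP; rewrite eq_le measure_ge0 andbT leNgt; apply/negP => Ak.
  by apply: nd; exists k.+1%:R^-1.
suff : m (pos_cap u) = 0%E by move=> E; move: H; rewrite E ltxx.
apply/eqP; rewrite eq_le measure_ge0 andbT.
have sub : pos_cap u `<=` \bigcup_k A k.
  move=> x [Sx ux]; exists (Num.truncn (dotv u x)^-1) => //; split => //.
  by rewrite -[leRHS]invrK lef_pV2 ?posrE ?invr_gt0//; apply: ltW;
    exact: truncnS_gt.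
apply: le_trans (measure_sigma_subadditive _ _ _ _) _;
  [exact: mA|exact: measurable_pos_cap|exact: sub|].
by rewrite eseries0// => k _ _; rewrite A0.
Qed.

Hypothesis mfin : (m S < +oo)%E.

(** Growth of [F x] is given for each [x] separately. The sets [Aj] where [F x] has reached the
    level [K] at [j.+1] increase to the cap [A], so one of them carries more than half of its mass,
    and monotonicity keeps [F x] above [K] from there on. The level [K] is chosen so that this half
    outweighs [C] and the possible loss [M] over the whole sphere. *)
Lemma coercive_at (F : V -> R -> R) (M C d : R) (u : V) :
  in_CI F -> (forall x, S x -> F x t @[t --> +oo] --> +oo) -> 0 <= M ->
  0 < d -> (0 < m [set x | S x /\ (d <= dotv u x)%R])%E ->
  exists2 s0, 0 < s0 & forall (w : V -> R),
    {within S, continuous w} -> (forall x, S x -> 0 < w x) ->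
    (forall x, S x -> - M <= F x (w x)) ->
    (forall x, S x -> d <= dotv u x -> s0 <= w x) ->
    C < \int[m]_(x in (S : set B)) F x (w x).
Proof.
move=> FCI Fy M0 d0; set A : set B := [set x | _] => A0.
have [FC _] := FCI.
have mS := @measurable_sphere R n.
have mA : measurable A by exact: measurable_cap.
have AS : A `<=` S by move=> x [].
have Afin : (m A < +oo)%E by apply: le_lt_trans mfin; rewrite le_measure ?inE.
pose a := fine (m A).
have aE : m A = a%:E by rewrite fineK// ge0_fin_numE.
have a0 : 0 < a by rewrite -lte_fin -aE.
pose K := (`|C| + 1 + M * fine (m S)) / (a / 2).
have Kp : 0 <= K.
  apply: divr_ge0; last by rewrite divr_ge0// ltW.
  by rewrite !addr_ge0// mulr_ge0// fine_ge0.
pose Aj j : set B := A `&` [set x | K <= F x j.+1%:R].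
have mAj j : measurable (Aj j).
  have -> : Aj j = A `&` (S `&` (fun x => F x j.+1%:R) @^-1` `[K, +oo[).
    apply/seteqP; split => x /=; rewrite in_itv /= andbT; first by move=> [] [].
    by move=> [] [] ? ? [].
  apply: measurableI => //.
  have [mf _] := @CI_bm F (fun=> j.+1%:R) FC (@cst_continuous _ _ _)
    (fun _ _ => ltr0Sn _ _).
  by apply: mf => //; exact: measurable_itv.
have Anu : \bigcup_j Aj j = A.
  apply/seteqP; split => [x [j _ []]//|x Ax].
  have := Fy x (AS _ Ax); move=> /cvgryPge /(_ K) [T [_ HT]].
  exists (Num.truncn T) => //; split => //=; apply: HT.
  exact: truncnS_gt.
have ndA : {homo Aj : i j / (i <= j)%N >-> (i <= j)%O}.
  move=> i j ij; apply/subsetPset => x [Ax /= H]; split => //=.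
  apply: le_trans H _; apply: CI_le => //; first exact: AS.
  by rewrite ler_nat.
have := nondecreasing_cvg_mu (mu := m) mAj; rewrite Anu => /(_ mA ndA).
rewrite aE => cA.
have : \forall j \near \oo, ((a / 2)%:E < m (Aj j))%E.
  have /(_ [set y | ((a / 2)%:E < y)%E]) := cA; apply.
  by apply: open_nbhs_nbhs; split;
    [exact: open_ereal_gt_ereal|rewrite /= lte_fin ltr_pdivrMr//
    mulr_natr mulr2n ltrDl].
move=> [j _ /(_ j (leqnn j)) Hj].
have Ajfin : (m (Aj j) < +oo)%E.
  by apply: le_lt_trans Afin; rewrite le_measure ?inE//; exact: subIsetl.
exists j.+1%:R => // w cw w0 wM wj.
have bF := CI_bm FC cw w0.
(* A minorant of the integrand; as [M >= 0], it is harmless to subtract [M] on [Aj] as well. *)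
pose g (x : B) : R := K * \1_(Aj j) x - M.
have bI : bounded_measurable (S : set B) (fun x : B => \1_(Aj j) x : R).
  split; first exact: measurable_indic.
  by exists 1 => x _; rewrite indicE; case: (_ \in _); rewrite ?normr1 ?normr0.
have bg : bounded_measurable (S : set B) g.
  by apply: bmB; [apply: bmM => //; exact: bm_cst|exact: bm_cst].
have gF x : S x -> g x <= F x (w x).
  move=> Sx; rewrite /g indicE; have [|] := boolP (x \in Aj j).
    rewrite inE => -[[_ ux] /= HK]; rewrite mulr1.
    apply: (@le_trans _ _ K); first by rewrite gerBl.
    by apply: le_trans HK _; apply: CI_le => //; exact: wj.
  by move=> _; rewrite mulr0 sub0r wM.
apply: lt_le_trans (bm_le_integral mS mfin bg bF gF).
rewrite /g bm_integralB//; last first.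
- exact: bm_cst.
- by apply: bmM => //; exact: bm_cst.
rewrite bm_integralZl// bm_integral_cst//.
have -> : \int[m]_(x in (S : set B)) (\1_(Aj j) x : R) = fine (m (Aj j)).
  rewrite /Rintegral integral_indic// setIidl//.
  by move=> x [] /AS.
have Hj' : a / 2 < fine (m (Aj j)).
  by rewrite -lte_fin fineK// ge0_fin_numE.
rewrite ltrBrDr; apply: (@lt_le_trans _ _ (K * (a / 2))); last first.
  by rewrite ler_wpM2l// ltW.
rewrite /K divfK ?gt_eqF ?divr_gt0//.
have := ler_norm C; lra.
Qed.

(* The neighbourhoods and thresholds of [coercive_at] are made uniform in the
   direction by compactness of the sphere. *)
Lemma coercive (F : V -> R -> R) (M C : R) :
  in_CI F -> (forall x, S x -> F x t @[t --> +oo] --> +oo) -> 0 <= M ->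
  not_concentrated m ->
  exists2 s0, 0 < s0 & forall (w : V -> R) (u : V) (s : R),
    {within S, continuous w} -> (forall x, S x -> 0 < w x) ->
    (forall x, S x -> - M <= F x (w x)) ->
    S u -> s0 <= s -> (forall x, S x -> s * dotv u x <= w x) ->
    C < \int[m]_(x in (S : set B)) F x (w x).
Proof.
move=> FCI Fy M0 nc.
pose P (s : R) (u : V) := forall (w : V -> R),
    {within S, continuous w} -> (forall x, S x -> 0 < w x) ->
    (forall x, S x -> - M <= F x (w x)) ->
    (forall x, S x -> s * dotv u x <= w x) ->
    C < \int[m]_(x in (S : set B)) F x (w x).
suff : \forall s \near +oo, S `<=` P s.
  move=> [T [_ HT]]; exists (Num.max T 0 + 1);
    first by rewrite ltr_wpDl// le_max lexx orbT.
  move=> w u s cw w0 wM Su sT sw; have Ts : T < s.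
    by apply: lt_le_trans sT; rewrite ltr_pwDr// le_max lexx.
  exact: (HT s Ts u Su w cw w0 wM sw).
have /compact_near_coveringP nc' := @compact_sphere R n.
apply: (nc' R (pinfty_nbhs R) P _) => u Su.
have [d d0 Hd] := cap_measure_gt0 ((integral_pos_part_gt0 u).1 (nc u Su)).
have [s0 s00 Hs] := @coercive_at F M C d u FCI Fy M0 d0 Hd.
(* Within this radius the product with [x] changes by at most [d / 2], so on the cap of height [d]
   it stays at least [d / 2] for every nearby direction. *)
have r0 : 0 < d / 2 / n.+1%:R by rewrite !divr_gt0.
exists (ball u (d / 2 / n.+1%:R), [set s | s0 / (d / 2) <= s]) => /=.
  split; first exact: nbhsx_ballx.
  by exists (s0 / (d / 2)); split; [exact: num_real|move=> x /ltW].
move=> [u' s] /= []; rewrite -ball_normE /= => /ltW uu' ss w cw w0 wM sw.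
apply: Hs => // x Sx ux; apply: le_trans (sw x Sx).
have d2 : 0 < d / 2 by rewrite divr_gt0.
rewrite -(divfK (lt0r_neq0 d2) s0); apply: ler_pM => //.
- by rewrite divr_ge0// ltW.
- exact: ltW.
have : `|dotv (u - u') x| <= d / 2.
  apply: le_trans (dotv_norm _ _) _.
  apply: (@le_trans _ _ (n.+1%:R * (d / 2 / n.+1%:R) * 1)).
    apply: ler_pM => //.
      by apply: ler_pM => //; rewrite ler_nat.
    exact: sphere_norm.
  by rewrite mulr1 mulrC divfK.
rewrite dotvBl ler_norml => /andP[_]; lra.
Qed.

End Coercivity.

(** * Existence of a minimizer *)

Section Compactness.
Variables (R : realType).

(** With an ultrafilter, bounded values converge at every point simultaneously, which replaces a
    diagonal extraction of subsequences. *)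
Lemma ultra_bounded_cvg (T : Type) (G : set_system T) (a : T -> R) (c : R) :
  UltraFilter G -> (forall k, `|a k| <= c) ->
  exists l : R, forall d : R, 0 < d -> \forall k \near G, `|a k - l| < d.
Proof.
move=> UG ac; have PG := @ultra_proper _ _ UG.
have FA : G [set k | `[- c, c]%classic (a k)].
  by apply: filterE => k; rewrite /= in_itv /= -ler_norml.
have [l [_ cl]] := @segment_compact R (- c) c (a @ G) _ FA.
exists l => d d0.
have [//|H] := in_ultra_setVsetC [set k | `|a k - l| < d] UG.
have Gb : (a @ G) [set y | ~ `|y - l| < d] by [].
have nb : nbhs l [set y | `|y - l| < d].
  by exists d => //= y /=; rewrite distrC.
by have [y [/= h1 h2]] := cl _ _ Gb nb.
Qed.

Variable n : nat.
Local Notation V := 'rV[R]_n.+1.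
Local Notation S := (@sphere R n.+1).

(* Equi-Lipschitz pointwise limits along an ultrafilter are uniform on the
   compact sphere: Blaschke selection for support functions. *)
Lemma polar_pair_compact (e : R) (h_ : nat -> V -> R) : 0 < e ->
  (forall k, polar_pair e (h_ k) (dual (h_ k))) ->
  exists h, polar_pair e h (dual h) /\
    forall (d : R) N, 0 < d ->
      exists2 k, (N <= k)%N & forall u, S u -> `|h_ k u - h u| <= d.
Proof.
move=> e0 hp.
have [G [UG subG]] := ultraFilterLemma (eventually_filter : ProperFilter \oo).
have PG := @ultra_proper _ _ UG.
pose L : R := n.+1%:R / e; have L0 : 0 < L by rewrite divr_gt0.
have lipk k x y : `|h_ k x - h_ k y| <= L * `|x - y|.
  exact: polar_lip_g e0 (polar_pair_sym e0 (hp k)) _ _.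
have bnd k x : `|h_ k x| <= L * `|x|.
  have := lipk k x 0; rewrite subr0.
  suff -> : h_ k 0 = 0 by rewrite subr0.
  by rewrite -(scale0r 0) (polarZ_g e0 (polar_pair_sym e0 (hp k)))// mul0r.
have /choice[h0 h0P] : forall x, exists l : R, forall d : R, 0 < d ->
  \forall k \near G, `|h_ k x - l| < d.
  by move=> x; exact: (ultra_bounded_cvg UG (fun k => bnd k x)).
have lip0 x y : `|h0 x - h0 y| <= L * `|x - y|.
  apply/ler_addgt0Pr => d d0; have d2 : 0 < d / 2 by rewrite divr_gt0.
  have [k [k1 k2]] := filter_ex (filterI (h0P x _ d2) (h0P y _ d2)).
  have := lipk k x y; move: k1 k2.
  rewrite !ltr_norml !ler_norml => /andP[? ?] /andP[? ?] /andP[? ?]; lra.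
have pinch0 : pinched e h0.
  move=> u Su; apply/andP; split; apply/ler_addgt0Pr => d d0;
    have [k k1] := filter_ex (h0P u _ d0); move: k1;
      rewrite ltr_norml => /andP[? ?];
    have /andP[? ?] := polar_pinched (hp k) Su; lra.
have unif d : 0 < d -> \forall k \near G, forall u, S u ->
  `|h_ k u - h0 u| <= d.
  move=> d0; have /compact_near_coveringP nc := @compact_sphere R n.+1.
  apply: (nc nat G (fun k u => `|h_ k u - h0 u| <= d)) => x Sx.
  have d2 : 0 < d / 2 by rewrite divr_gt0.
  have r0 : 0 < d / 4 / L by rewrite !divr_gt0.
  exists (ball x (d / 4 / L), [set k | `|h_ k x - h0 x| < d / 2]) => /=.
    by split; [exact: nbhsx_ballx|exact: h0P].
  move=> [x' k] /= []; rewrite -ball_normE /= => /ltW xx' k1.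
  have xL : L * `|x - x'| <= d / 4 by rewrite mulrC -ler_pdivlMr.
  have := lipk k x x'; have := lip0 x x'; move: k1.
  rewrite !ltr_norml !ler_norml => /andP[? ?] /andP[? ?] /andP[? ?]; apply/andP;
    split; lra.
have dd0 u : S u -> dual (dual h0) u = h0 u.
  move=> Su; apply/eqP; rewrite -subr_eq0 -normr_eq0 eq_le normr_ge0 andbT.
  apply/ler_addgt0Pr => d d0; rewrite add0r.
  (* [c] adds the error of [h_ k] itself to that of its double dual, where [dual_dist] contributes
     the factor [e ^- 2] twice. *)
  pose c := 1 + (e ^+ 2)^-1 ^+ 2;
    have c0 : 0 < c by rewrite ltr_wpDr// exprn_ge0// invr_ge0 exprn_ge0// ltW.
  have dc : 0 < d / c by rewrite divr_gt0.
  have [k Hk] := filter_ex (unif _ dc).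
  have pk := polar_pinched (hp k).
  have H1 : forall x, S x -> `|dual (h_ k) x - dual h0 x| <= d / c / e ^+ 2.
    by move=> x Sx; apply: dual_dist.
  have H2 : `|dual (dual (h_ k)) u - dual (dual h0) u| <= d / c / e ^+ 2 / e ^+
    2.
    by apply: dual_dist => //; exact: pinched_dual.
  have E : dual (dual (h_ k)) = h_ k by case: (hp k) => _ <-.
  rewrite E in H2; have H3 := Hk u Su.
  have -> : d = d / c / e ^+ 2 / e ^+ 2 + d / c.
    by rewrite -[in LHS](divfK (lt0r_neq0 c0) d) {2}/c; field; rewrite !gt_eqF.
  move: H2 H3; set p := _ / e ^+ 2; set q := d / c; rewrite !ler_norml.
  by move=> /andP[? ?] /andP[? ?]; apply/andP; split; lra.
(* [polar_pair] asks for equality of functions, while [dd0] compares [h0] with its double dual on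
   the sphere only; hence the double dual is the witness. *)
exists (dual (dual h0)); split; first exact: polar_pair_dual.
move=> d N d0.
have GN : G [set k | (N <= k)%N] by apply: subG; exists N.
have [k [k1 k2]] := filter_ex (filterI (unif _ d0) GN).
by exists k => // u Su; rewrite dd0// k1.
Qed.

End Compactness.

Section Optimal.
Variables (R : realType) (n : nat).
Local Notation V := 'rV[R]_n.+1.
Local Notation B := (Borel R n.+1).
Local Notation S := (@sphere R n.+1).

Lemma integral_lip (m : {measure set B -> \bar R}) (F : V -> R -> R) (e : R) :
  (m S < +oo)%E -> in_C F -> 0 < e ->
  exists2 K, 0 < K & forall (w w' : V -> R) d,
    {within S, continuous w} -> {within S, continuous w'} ->
    pinched e w -> pinched e w' -> (forall u, S u -> `|w u - w' u| <= d) ->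
    `|\int[m]_(x in (S : set B)) F x (w x) - \int[m]_(x in (S : set B)) F x
      (w' x)| <= K * d.
Proof.
move=> mfin FC e0; have [L [L0 HL]] := dt_bounded FC e0.
(* The added 1 keeps the constant positive even when [m S] is 0. *)
exists (L * fine (m S) + 1).
  by rewrite ltr_wpDl// mulr_ge0// ?fine_ge0// ltW.
move=> w w' d cw cw' pw pw' ww'.
have w0 u : S u -> 0 < w u by exact: pinched_gt0 e0 pw.
have w0' u : S u -> 0 < w' u by exact: pinched_gt0 e0 pw'.
have d0 : 0 <= d.
  by have [u Su] := sphere_nonempty R n; exact: le_trans (ww' u Su).
apply: (@le_trans _ _ (L * d * fine (m S))); last first.
  by rewrite mulrDl mul1r -mulrA (mulrC d) mulrA lerDl.
apply: bm_integral_dist => //.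
- exact: measurable_sphere.
- exact: CI_bm.
- exact: CI_bm.
move=> x Sx; apply: (@le_trans _ _ (L * `|w x - w' x|)).
  by apply: (C_lip FC e0 HL) => //; [exact: pw|exact: pw'].
by rewrite ler_pM2l// ww'.
Qed.

Variables (m1 m2 : {measure set B -> \bar R}) (F1 F2 : V -> R -> R).
Hypotheses (m1fin : (m1 S < +oo)%E) (m2fin : (m2 S < +oo)%E).
Hypotheses (nc1 : not_concentrated m1) (nc2 : not_concentrated m2).
Hypotheses (F1I : in_CI F1) (F2I : in_CI F2).
Hypotheses (F1y : forall x, S x -> F1 x t @[t --> +oo] --> +oo).
Hypotheses (F2y : forall x, S x -> F2 x t @[t --> +oo] --> +oo).
Hypothesis F2pos : forall x t, S x -> 0 < t -> 0 < F2 x t.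

Local Notation Phi h := (\int[m1]_(x in (S : set B)) F1 x (h x)).
Local Notation W g := (\int[m2]_(x in (S : set B)) F2 x (g x)).

Let F1C : in_C F1. Proof. by case: F1I. Qed.
Let F2C : in_C F2. Proof. by case: F2I. Qed.

Lemma polar_within e h g : 0 < e -> polar_pair e h g ->
  {within S, continuous h}.
Proof. by move=> e0 hg; apply: continuous_subspaceT;
  exact: polar_continuous e0 hg. Qed.

Lemma polar_within_g e h g : 0 < e -> polar_pair e h g ->
  {within S, continuous g}.
Proof. by move=> e0 hg; exact: polar_within e0 (polar_pair_sym e0 hg). Qed.

(** If [h u] is small, then [dual h x >= dotv u x / h u] forces [W] above [C] by coercivity.
    Positivity of [F2] provides the required lower bound on the integrand, with [M = 0]. *)
Lemma polar_lower (C : R) : exists2 a, 0 < a & forall e h, 0 < e ->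
  polar_pair e h (dual h) -> W (dual h) <= C -> forall u, S u -> a <= h u.
Proof.
have [s0 s00 H] := @coercive R n.+1 m2 m2fin F2 0 C F2I F2y (lexx 0) nc2.
exists s0^-1; first by rewrite invr_gt0.
move=> e h e0 hg WC u Su; rewrite leNgt; apply/negP => hu.
move: WC; rewrite leNgt => /negP; apply.
have hu0 := polar_gt0 e0 hg Su.
apply: (H (dual h) u (h u)^-1) => //.
- exact: polar_within_g e0 hg.
- by move=> x Sx; exact: (polar_gt0_g e0 hg Sx).
- by move=> x Sx; rewrite oppr0 ltW// F2pos// (polar_gt0_g e0 hg).
- by rewrite -[s0]invrK lef_pV2 ?posrE ?invr_gt0// ltW.
- by move=> x Sx; rewrite mulrC ler_pdivrMr// (polar_ineq e0 hg).
Qed.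

(** The lower bound on [h] from [polar_lower] keeps [F1 x (h x)] above [- M], so coercivity now
    applies to [Phi] too: a small value of the gauge would push [Phi] above [C']. A gauge that is at
    least [s0^-1] means [h <= s0]. *)
Lemma polar_upper (C C' : R) : exists2 b, 0 < b & forall e h, 0 < e ->
  polar_pair e h (dual h) -> W (dual h) <= C -> Phi h <= C' ->
  forall u, S u -> b <= h u <= b^-1.
Proof.
have [a a0 Ha] := polar_lower C.
have cF1 : {within S, continuous (fun u => F1 u a)}.
  by apply: (within_comp_F F1C (w := fun=> a)) => //;
    apply: continuous_subspaceT; exact: cst_continuous.
have [_ [M0 HM]] := bm_continuous cF1; pose M := `|M0|.
have M00 : 0 <= M by exact: normr_ge0.
have [s0 s00 H] := @coercive R n.+1 m1 m1fin F1 M C' F1I F1y M00 nc1.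
exists (Num.min a s0^-1); first by rewrite lt_min a0 invr_gt0.
move=> e h e0 hg WC PC u Su.
have hu := Ha e h e0 hg WC.
apply/andP; split; first by rewrite ge_min hu.
have gb x : S x -> s0^-1 <= dual h x.
  move=> Sx; rewrite leNgt; apply/negP => gx.
  move: PC; rewrite leNgt => /negP; apply.
  have gx0 := polar_gt0_g e0 hg Sx.
  apply: (H h x (dual h x)^-1) => //.
  - exact: polar_within e0 hg.
  - by move=> y Sy; exact: (polar_gt0 e0 hg Sy).
  - move=> y Sy; apply: (@le_trans _ _ (F1 y a)); last by apply: CI_le => //;
    exact: hu.
    have := HM y Sy; rewrite ler_norml => /andP[+ _]; apply: le_trans.
    by rewrite lerN2 ler_norm.
  - by rewrite -[s0]invrK lef_pV2 ?posrE ?invr_gt0// ltW.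
  - by move=> y Sy; rewrite mulrC ler_pdivrMr// mulrC dotvC (polar_ineq e0 hg).
apply: (@le_trans _ _ s0); last first.
  by rewrite -[leLHS]invrK lef_pV2 ?posrE ?invr_gt0 ?lt_min ?a0 ?invr_gt0//
    ge_min lexx orbT.
case: (hg) => _ -> _; rewrite -[s0]invrK.
by apply: dual_le_sphere => //; rewrite invr_gt0.
Qed.

(** The constraint is stated with the value of [W] at the minimizer itself, so the result reads as
    optimality for the pair of functionals, with no reference to the level [C]. *)
Lemma optimal_pair : exists e h, [/\ 0 < e, polar_pair e h (dual h) &
  forall e' h', 0 < e' -> polar_pair e' h' (dual h') ->
    W (dual h') <= W (dual h) -> Phi h <= Phi h'].
Proof.
have one1 : pinched 1 (fun=> 1 : R) by move=> u Su; rewrite invr1 lexx.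
pose h0 : V -> R := dual (dual (fun=> 1)).
have hg0 : polar_pair 1 h0 (dual h0) by apply: polar_pair_dual.
(* The level attained by the unit ball, so that the constraint is satisfiable. *)
pose C := W (dual h0).
pose A := [set y | exists e h,
  [/\ 0 < e, polar_pair e h (dual h), W (dual h) <= C & y = Phi h]].
have A0 : A (Phi h0) by exists 1, h0; split.
have [a a0 Ha] := polar_lower C.
have cF1 : {within S, continuous (fun u => F1 u a)}.
  by apply: (within_comp_F F1C (w := fun=> a)) => //;
    apply: continuous_subspaceT; exact: cst_continuous.
have mS := @measurable_sphere R n.+1.
have Alb : has_inf A.
  split; first by exists (Phi h0).
  exists (\int[m1]_(x in (S : set B)) F1 x a) => _ [e [h [e0 hg WC ->]]].
  apply: bm_le_integral => //.
  - exact: bm_continuous.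
  - apply: CI_bm => //; first exact: polar_within e0 hg.
    by move=> u Su; exact: (polar_gt0 e0 hg Su).
  - by move=> x Sx; apply: CI_le => //; exact: (Ha e h).
have k0 k : 0 < k.+1%:R^-1 :> R by rewrite invr_gt0.
have seqP k : exists h, exists2 e, 0 <
  e & [/\ polar_pair e h (dual h), W (dual h) <= C & Phi h <
  inf A + k.+1%:R^-1].
  have [_ [e [h [e0 hg WC ->]]] Hy] := inf_adherent (k0 k) Alb.
  by exists h, e.
have {seqP}/choice[h_ Hh] := seqP.
(* Each member of the minimizing sequence comes with its own constant; since [Phi] stays below
   [inf A + 1], a single [b] serves for all of them. *)
have [b b0 Hb] := polar_upper C (inf A + 1).
have hk k : polar_pair b (h_ k) (dual (h_ k)).
  have [e e0 [hg WC PC]] := Hh k; case: (hg) => ph hE gE; split => // u Su.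
  apply: (Hb e) => //; apply: ltW; apply: lt_le_trans PC _; rewrite lerD2l.
  by rewrite invf_le1// ler1n.
have [h [hg cvg]] := polar_pair_compact b0 hk.
have [K1 K10 L1] := integral_lip m1fin F1C b0.
have [K2 K20 L2] := integral_lip m2fin F2C b0.
have W1 : W (dual h) <= C.
  apply/ler_addgt0Pr => d d0.
  have d1 : 0 < d / K2 * b ^+ 2 by rewrite mulr_gt0 ?divr_gt0// exprn_gt0.
  have [k _ Hk] := cvg _ 0%N d1.
  have [e e0 [_ WC _]] := Hh k.
  have := @L2 (dual (h_ k)) (dual h) (d / K2) _ _ _ _ _.
  move=> /(_ (polar_within_g b0 (hk k)) (polar_within_g b0 hg)
    (polar_pinched_g b0 (hk k)) (polar_pinched_g b0 hg)).
  have Hd u : S u -> `|dual (h_ k) u - dual h u| <= d / K2.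
    move=> Su; have := dual_dist b0 (polar_pinched (hk k)) (polar_pinched hg) Su
      Hk.
    by rewrite mulfK// gt_eqF// exprn_gt0.
  move=> /(_ Hd); rewrite mulrC divfK ?gt_eqF// ler_norml => /andP[H _].
  rewrite -/C in WC *; lra.
have P1 : Phi h <= inf A.
  apply/ler_addgt0Pr => d d0; have d2 : 0 < d / 2 by rewrite divr_gt0.
  have d1 : 0 < d / 2 / K1 by rewrite divr_gt0.
  have [k kN Hk] := cvg _ (Num.truncn (d / 2)^-1) d1.
  have [e e0 [_ _ PC]] := Hh k.
  have := @L1 (h_ k) h (d / 2 / K1) (polar_within b0 (hk k))
    (polar_within b0 hg)
    (polar_pinched (hk k)) (polar_pinched hg) Hk.
  rewrite mulrC divfK ?gt_eqF// ler_norml => /andP[H _].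
  have kd : k.+1%:R^-1 <= d / 2.
    rewrite -[leRHS]invrK lef_pV2 ?posrE ?invr_gt0//.
    by apply: ltW; apply: lt_le_trans (truncnS_gt _) _; rewrite ler_nat.
  have {PC} : Phi (h_ k) < inf A + d / 2 by apply: lt_le_trans PC _;
    rewrite lerD2l.
  lra.
(* A competitor with [W (dual h') <= W (dual h)] also satisfies the original constraint, because
   [W (dual h) <= C]. *)
exists b, h; split => // e' h' e'0 hg' W'.
apply: le_trans P1 _; apply: ge_inf; first by case: Alb.
by exists e', h'; split => //; exact: le_trans W1.
Qed.

End Optimal.

(** * First variation *)

Lemma measure_bigcup_eq0 d (T : measurableType d) (R : realType)
    (mu : {measure set T -> \bar R}) (A : (set T)^nat) :
  (forall k, measurable (A k)) -> (forall k, mu (A k) = 0%E) ->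
  mu (\bigcup_k A k) = 0%E.
Proof.
move=> mA A0; apply/eqP; rewrite eq_le measure_ge0 andbT.
apply: le_trans (measure_sigma_subadditive _ _ _ _) _;
  [exact: mA|exact: bigcupT_measurable|exact: subset_refl|].
by rewrite eseries0// => k _ _; rewrite A0.
Qed.

Section NormalMap.
Variables (R : realType) (n : nat).
Local Notation V := 'rV[R]_n.+1.
Local Notation B := (Borel R n.+1).
Local Notation S := (@sphere R n.+1).
Variables (e : R) (h g : V -> R).
Hypotheses (e0 : 0 < e) (hg : polar_pair e h g).

(** The contact relation is closed and the sphere compact, so preimages of closed sets under the
    multivalued normal map are closed; measurability of its selection rests on this. *)
Lemma closed_contact_image (F : set V) : closed F ->
  closed [set x | S x /\ exists2 u, F u & contact h g x u].
Proof.
move=> cF.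
have cS := @compact_sphere R n.+1.
pose X : set (V * V) := S `*` (S `&` F).
have cX : compact X by apply: compact_setX => //; exact: compact_closedI.
pose Y : set (V * V) := [set p | dotv p.2 p.1 = g p.1 * h p.2].
have cY : closed Y.
  have cg := polar_continuous_g e0 hg; have ch := polar_continuous e0 hg.
  apply: closed_eq_fun.
    by apply: continuous_dotv => p; [exact: cvg_snd|exact: cvg_fst].
  move=> p; apply: (@cvgM _ _ (nbhs p)).
    by apply: (@continuous_comp _ _ _ fst g); [exact: cvg_fst|exact: cg].
  by apply: (@continuous_comp _ _ _ snd h); [exact: cvg_snd|exact: ch].
have cXY : compact (X `&` Y) by exact: compact_closedI.
rewrite (_ : [set x | _] = fst @` (X `&` Y)); last first.
  apply/seteqP; split => [x [Sx [u Fu [Su E]]]|_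
    [[x u] [[/= Sx [Su Fu]] E] <-]].
    by exists (x, u).
  by split => //; exists u.
apply: compact_closed; first exact: norm_hausdorff.
apply: continuous_compact => //; apply: continuous_subspaceT => p;
  exact: cvg_fst.
Qed.

Variable lam : {measure set B -> \bar R}.
Hypothesis lamM : in_M lam.

(** The arbitrary choice [alpha] may fail to be measurable. The map [a] selects the unique normal
    off the null set [N] of kinks and is constant on [N], which makes it measurable. *)
Lemma normal_map : exists (N : set B) (a : V -> V),
  [/\ measurable N, lam N = 0%E,
      measurable_fun (S : set B) (a : B -> B),
      (forall x, S x -> S (a x)) &
      forall x, S x -> ~ N x -> contact h g x = [set a x]].
Proof.
(* [inord] turns the union over the coordinates into one over the naturals. *)
pose N : set B := \bigcup_j \bigcup_k kink h g (inord j) k.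
have mK i k : measurable (kink h g i k : set B) by apply: measurable_closed;
  exact: closed_kink e0 hg _ _.
have mN : measurable N by do 2 apply: bigcupT_measurable => ?; exact: mK.
have N0 : lam N = 0%E.
  have K0 i k : lam (kink h g i k) = 0%E.
    case: lamM => _; apply;
      [exact: mK|by move=> x []|exact: spherical_null_kink e0 hg _ _].
  apply: measure_bigcup_eq0 => [j|j]; first by apply: bigcupT_measurable => k;
    exact: mK.
  by apply: measure_bigcup_eq0.
have [c0 Sc0] := sphere_nonempty R n.
pose a x := if `[< N x >] then c0 else xget c0 (contact h g x).
have aP x : S x -> ~ N x -> contact h g x = [set a x].
  move=> Sx Nx; have [u cu] := contact_nonempty e0 hg x.
  have ax : contact h g x (a x).
    by rewrite /a asboolF//; apply: xgetPex; exists u.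
  apply/seteqP; split => [v cv|_ ->//];
    apply: (contact_unique e0 hg Sx) cv ax => i k Kx.
  by apply: Nx; exists (i : nat) => //; exists k => //; rewrite inord_val.
exists N, a; split => //; last first.
  move=> x Sx; have [Nx|Nx] := pselect (N x); first by rewrite /a asboolT.
  have [] // : contact h g x (a x).
  by rewrite (aP x Sx Nx).
have mclosed (F : set V) : closed F -> measurable ((S : set B) `&` a @^-1` F).
  move=> cF; pose X : set B :=
    [set x | S x /\ exists2 u, F u & contact h g x u].
  have mX : measurable X by apply: measurable_closed;
    exact: closed_contact_image.
  have mS := @measurable_sphere R n.+1.
  have -> : (S : set B) `&` a @^-1` F =
      (X `\` N) `|` (if `[< F c0 >] then S `&` N else set0).
    apply/seteqP; split => x /=.
      move=> [Sx Fx]; have [Nx|Nx] := pselect (N x).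
        by right; move: Fx; rewrite /a asboolT// => /asboolT ->.
      left; split => //; split => //; exists (a x) => //.
      by rewrite (aP x Sx Nx).
    move=> [[[Sx [u Fu cu]] Nx]|]; first by split => //; move: cu;
      rewrite (aP x Sx Nx) => <-.
    case: asboolP => // Fc0 [Sx Nx]; split => //.
    by rewrite /a asboolT.
  apply: measurableU; first exact: measurableD.
  by case: ifP => _; [exact: measurableI|exact: measurable0].
apply: (@measurability _ _ B B S a (@open V) erefl) => _ [U oU <-].
have -> : (S : set B) `&` a @^-1` U = S `\` (S `&` a @^-1` (~` U)).
  apply/seteqP; split => x /=; first by move=> [Sx Ux]; split => // -[_]; exact.
  by move=> [Sx H]; split => //; apply: contrapT => Ux; apply: H.
apply: measurableD; first exact: measurable_sphere.
by apply: mclosed; exact: open_closedC.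
Qed.

End NormalMap.

Section Perturbation.
Variables (R : realType) (n : nat).
Local Notation V := 'rV[R]_n.+1.
Local Notation S := (@sphere R n.+1).
Variables (e : R) (h g : V -> R).
Hypotheses (e0 : 0 < e) (hg : polar_pair e h g).
Variables (phi : V -> R) (b : R).
Hypotheses (cphi : {within S, continuous phi}) (b0 : 0 < b).
Hypothesis phib : forall u, S u -> `|phi u| <= b.

(* With this parametrization [dotv u x / pert t u] is affine in [t]. *)
Definition pert (t : R) (u : V) : R := h u / (1 - t * phi u).

Section Fixed.
Variable t : R.
Hypotheses (t0 : 0 <= t) (tb : t * b <= 2^-1).

Lemma pert_denom u : S u -> 2^-1 <= 1 - t * phi u <= 3 / 2.
Proof.
move=> Su; have : `|t * phi u| <= 2^-1.
  by rewrite normrM ger0_norm//; apply: le_trans tb; rewrite ler_wpM2l// phib.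
by rewrite ler_norml => /andP[? ?]; apply/andP; split; lra.
Qed.

Lemma pert_denom_gt0 u : S u -> 0 < 1 - t * phi u.
Proof. by move=> /pert_denom /andP[H _]; apply: lt_le_trans H. Qed.

Lemma pinched_pert : pinched (e / 2) (pert t).
Proof.
move=> u Su; have /andP[d1 d2] := pert_denom Su; have d0 := pert_denom_gt0 Su.
have /andP[h1 h2] := polar_pinched hg Su.
rewrite /pert; apply/andP; split.
  rewrite ler_pdivlMr//; apply: (@le_trans _ _ (e * 1)); last by rewrite mulr1.
  rewrite -mulrA ler_pM2l//; lra.
rewrite ler_pdivrMr// invfM invrK; apply: (le_trans h2).
by rewrite -mulrA; apply: ler_peMr; [rewrite invr_ge0 ltW|lra].
Qed.

Lemma pert_dist u : S u -> `|pert t u - h u| <= 2 * b / e * t.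
Proof.
move=> Su; have /andP[d1 d2] := pert_denom Su; have d0 := pert_denom_gt0 Su.
have /andP[h1 h2] := polar_pinched hg Su; have h0 := polar_gt0 e0 hg Su.
have -> : pert t u - h u = h u * (t * phi u) / (1 - t * phi u).
  by rewrite /pert; field; rewrite gt_eqF.
rewrite !normrM normfV (gtr0_norm d0) (gtr0_norm h0) (ger0_norm t0)
  ler_pdivrMr//.
apply: (@le_trans _ _ (e^-1 * (t * b))).
  by apply: ler_pM => //; [exact: ltW|exact: mulr_ge0|rewrite ler_wpM2l// phib].
have H : 0 <= e^-1 * (t * b) by rewrite !mulr_ge0 ?invr_ge0// ltW.
have -> : 2 * b / e * t * (1 - t * phi u) =
  e^-1 * (t * b) * (2 * (1 - t * phi u)) by ring.
by apply: ler_peMr => //; lra.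
Qed.

Lemma pert_within : {within S, continuous (pert t)}.
Proof.
move/subspace_continuousP : cphi => cp; apply/subspace_continuousP => u Su.
apply: cvgM; first by apply: cvg_within_filter; exact: polar_continuous e0 hg _.
apply: cvgV; first by rewrite gt_eqF// pert_denom_gt0.
by apply: cvgB; [exact: cvg_cst|apply: cvgM; [exact: cvg_cst|exact: cp]].
Qed.

Lemma dual_pert_dist x : S x -> `|dual (pert t) x - g x| <= 8 * b / e ^+ 3 * t.
Proof.
move=> Sx; have e20 : 0 < e / 2 by rewrite divr_gt0.
have ph : pinched (e / 2) h.
  by apply: (pinched_le e20 _ (polar_pinched hg));
    rewrite ler_pdivrMr// ler_peMr ?ler1n// ltW.
have := dual_dist e20 pinched_pert ph Sx pert_dist.
case: hg => _ _ <-; move=> /le_trans; apply; rewrite le_eqVlt; apply/orP; left.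
by apply/eqP; field; rewrite gt_eqF.
Qed.

End Fixed.

(** An envelope argument: [dual (pert t) x] is the supremum over [u] of [q u - t * psi u], affine in
    [t]. Testing with [al] gives the lower bound. For the upper one, directions near [al] satisfy
    [psi u >= psi al - eta], and by compactness all others have [q u <= g x - kap], so they cannot
    compete once [t] is small. *)
Lemma dual_pert_derivative x al (t_ : nat -> R) : S x ->
  contact h g x = [set al] -> (forall k, 0 < t_ k) ->
    (forall k, t_ k * b <= 2^-1) ->
  t_ @ \oo --> 0 ->
  (fun k => (dual (pert (t_ k)) x - g x) / t_ k) @ \oo --> - (phi al * g x).
Proof.
move=> Sx cal t0 tb ct.
have [Sal alE] : contact h g x al by rewrite cal.
pose q u := dotv u x / h u.
have qg u : S u -> q u <= g x.
  by move=> Su; rewrite ler_pdivrMr ?(polar_gt0 e0 hg)// (polar_ineq e0 hg).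
have qal : q al = g x by rewrite /q alE mulfK// gt_eqF// (polar_gt0 e0 hg).
have qlt u : S u -> u != al -> q u < g x.
  move=> Su ual; rewrite lt_neqAle qg// andbT; apply: contra ual => /eqP E.
  have : contact h g x u.
    by split => //; rewrite -E /q divfK// gt_eqF// (polar_gt0 e0 hg).
  by rewrite cal => ->.
have cq : {within S, continuous q} by apply: (polar_ratio_continuous e0 hg).
move/subspace_continuousP : (cq) => cq'.
move/subspace_continuousP : (cphi) => cp'.
have e20 : 0 < e / 2 by rewrite divr_gt0.
have plb k := pinched_lb (pinched_pert (ltW (t0 k)) (tb k)).
have termE k u : S u -> dotv u x / pert (t_ k) u = q u - t_ k * (phi u * q u).
  move=> Su; have d0 := pert_denom_gt0 (ltW (t0 k)) (tb k) Su.
  rewrite /pert /q; field.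
  by rewrite !gt_eqF// (polar_gt0 e0 hg).
have lower k : - (phi al * g x) <= (dual (pert (t_ k)) x - g x) / t_ k.
  rewrite ler_pdivlMr// lerBrDl.
  apply: le_trans (dual_ub e20 (plb k) x Sal); rewrite termE// qal.
  by rewrite mulNr mulrC.
apply/cvgrPdist_le => eta eta0.
pose psi u := phi u * q u.
pose P (kap : R) (u : V) := psi u >= psi al - eta \/ q u <= g x - kap.
have [kap kap0 Hkap] : exists2 kap, 0 < kap & forall u, S u -> P kap u.
  have /compact_near_coveringP/near_covering_withinP nc :=
    @compact_sphere R n.+1.
  have : \forall kap \near (0 : R)^'+, S `<=` P kap.
    apply: (nc R _ P) => u Su; have [->|ual] := eqVneq u al.
      have : nbhs al [set u' | S u' -> psi al - eta <= psi u'].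
        have cpsi : psi @ within S (nbhs al) --> psi al by apply: cvgM;
          [exact: cp'|exact: cq'].
        by apply: (cvgr_ge _ cpsi); rewrite gtrBl.
      move=> H; exists ([set u' | S u' -> psi al - eta <= psi u'], setT) => //=.
        by split => //; exact: filterT.
      by move=> [u' kap] /= [H' _] Su'; left; exact: H'.
    have qu := qlt u Su ual; pose c := (g x - q u) / 2.
    have c0 : 0 < c by rewrite divr_gt0// subr_gt0.
    have H : nbhs u [set u' | S u' -> q u' <= g x - c].
      have cc : c + c = g x - q u by rewrite /c -splitr.
      by apply: (cvgr_le _ (cq' u Su)); rewrite ltrBrDr -ltrBrDl -cc ltrDl.
    exists ([set u' | S u' -> q u' <= g x - c], [set kap | kap <= c]) => /=.
      by split => //; exact: nbhs_right_le.
    move=> [u' kap] /= [H' kc] Su'; right.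
    by apply: le_trans (H' Su') _; rewrite lerD2l lerN2.
  move=> near_kap; have [kap [kap0 Hk]] :=
    filter_ex (filterI (nbhs_right_gt 0) near_kap).
  by exists kap => // u Su; exact: Hk.
have [M0 M0P] : exists M, forall u, S u -> `|psi u| <= M.
  exists (b * (n.+1%:R / e * `|x|)) => u Su; rewrite normrM ler_pM// ?phib//.
  exact: (dual_term_le e0 (pinched_lb (polar_pinched hg))).
(* [M] dominates [psi al - psi u], so for [t * M < kap] the deficit [kap] outweighs anything gained
   from [psi]. *)
pose M := `|M0| + `|psi al| + 1.
have Mp : 0 < M by rewrite ltr_wpDl// addr_ge0.
have tn : \forall k \near \oo, t_ k < kap / M.
  by apply: (cvgr_lt _ ct); rewrite divr_gt0.
near=> k.
have tk : t_ k < kap / M by near: k; exact: tn.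
have tk0 := t0 k.
suff upper : (dual (pert (t_ k)) x - g x) / t_ k <= eta - phi al * g x.
  by have := lower k; rewrite ler_norml => ?; apply/andP; split; lra.
rewrite ler_pdivrMr//.
rewrite lerBlDl; apply: (dual_le e20 (plb k)) => u Su;
  rewrite termE// -/(psi u).
have psialE : psi al = phi al * g x by rewrite /psi qal.
case: (Hkap u Su) => H.
  have : t_ k * (psi al - eta) <= t_ k * psi u by rewrite ler_pM2l.
  by have := qg u Su; rewrite psialE; lra.
have kapE : t_ k * M < kap by rewrite -ltr_pdivlMr.
have : t_ k * (- M) <= t_ k * (psi u - psi al + eta).
  rewrite ler_pM2l//; have := M0P u Su; have := ler_norm M0;
    have := ler_norm (psi al).
  rewrite /M ler_norml => ? ? /andP[? ?]; lra.
rewrite psialE; lra.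
Unshelve. all: by end_near. Qed.

End Perturbation.

Section FirstVariation.
Variables (R : realType) (n : nat).
Local Notation V := 'rV[R]_n.+1.
Local Notation B := (Borel R n.+1).
Local Notation S := (@sphere R n.+1).

(** Differentiation under the integral by dominated convergence: [C_chain] gives the pointwise limit
    off [N], and [L * C] dominates the difference quotients. *)
Lemma integral_derivative (m : {measure set B -> \bar R}) (F : V -> R -> R)
    (e C : R) (w z : V -> R) (w_ : nat -> V -> R) (t_ : nat -> R) (N : set B) :
  (m S < +oo)%E -> in_C F -> 0 < e ->
  {within S, continuous w} -> pinched e w ->
  (forall k, {within S, continuous (w_ k)}) -> (forall k, pinched e (w_ k)) ->
  (forall k, 0 < t_ k) -> t_ @ \oo --> 0 ->
  (forall k x, S x -> `|w_ k x - w x| <= C * t_ k) ->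
  measurable N -> m N = 0%E ->
  (forall x, S x -> ~ N x -> (fun k => (w_ k x - w x) / t_ k) @ \oo --> z x) ->
  bounded_measurable (S : set B) (z : B -> R) ->
  (fun k => (\int[m]_(x in (S : set B)) F x (w_ k x) -
             \int[m]_(x in (S : set B)) F x (w x)) / t_ k) @ \oo -->
    \int[m]_(x in (S : set B)) (dt F x (w x) * z x).
Proof.
move=> mfin FC e0 cw pw cw_ pw_ t0 ct wC mN N0 cz bz.
have mS := @measurable_sphere R n.+1.
have w0 u : S u -> 0 < w u by exact: pinched_gt0 e0 pw.
have w0_ k u : S u -> 0 < w_ k u by exact: pinched_gt0 e0 (pw_ k).
have bF := CI_bm FC cw w0.
have bF_ k := CI_bm FC (cw_ k) (w0_ k).
have [L [L0 HL]] := dt_bounded FC e0.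
pose q k x := (t_ k)^-1 * (F x (w_ k x) - F x (w x)).
have bq k : bounded_measurable (S : set B) (q k : B -> R).
  by apply: bmM; [exact: bm_cst|exact: bmB].
rewrite (_ : (fun k => _) = fun k => \int[m]_(x in (S : set B)) q k x);
  last first.
  by apply/funext => k; rewrite mulrC -bm_integralB// -bm_integralZl//;
    exact: bmB.
apply: (@bm_integral_cvg _ _ _ m S mS mfin _ _ (L * C) N) => //.
- by move=> k; case: (bq k).
- by apply: bmM => //; apply: bm_continuous; exact: within_comp_dt.
- move=> k x Sx; rewrite /q normrM normfV (gtr0_norm (t0 k)) mulrC
  ler_pdivrMr//.
  apply: (@le_trans _ _ (L * `|w_ k x - w x|)).
    by apply: (C_lip FC e0 HL) => //; [exact: pw_|exact: pw].
  by rewrite -mulrA ler_pM2l// wC.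
- move=> x Sx Nx; rewrite (_ : (fun k => _) = fun k =>
  (F x (w_ k x) - F x (w x)) / t_ k).
    by apply: C_chain => //; [exact: w0|exact: cz].
  by apply/funext => k; rewrite /q mulrC.
Qed.

Variables (mu lam : {measure set B -> \bar R}) (Psi Gam : V -> R -> R).
Hypotheses (mufin : (mu S < +oo)%E) (lamfin : (lam S < +oo)%E).
Hypotheses (mupos : (0 < mu S)%E) (lampos : (0 < lam S)%E).
Hypotheses (PsiI : in_CI Psi) (GamI : in_CI Gam).
Variables (e : R) (h g : V -> R).
Hypotheses (e0 : 0 < e) (hg : polar_pair e h g).
Hypothesis pareto : forall e' h' g', 0 < e' -> polar_pair e' h' g' ->
  \int[mu]_(x in (S : set B)) Psi x (h' x) < \int[mu]_(x in (S : set B)) Psi x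
    (h x) ->
  \int[lam]_(x in (S : set B)) Gam x (g x) <= \int[lam]_(x in (S : set B)) Gam x
    (g' x).
Variables (N : set B) (a : V -> V).
Hypotheses (mN : measurable N) (N0 : lam N = 0%E).
Hypotheses (ma : measurable_fun (S : set B) (a : B -> B)).
Hypothesis aS : forall x, S x -> S (a x).
Hypothesis aE : forall x, S x -> ~ N x -> contact h g x = [set a x].

Let mS := @measurable_sphere R n.+1.
Let h0 u : S u -> 0 < h u. Proof. exact: polar_gt0 e0 hg u. Qed.
Let g0 u : S u -> 0 < g u. Proof. exact: polar_gt0_g e0 hg u. Qed.
Let ch : {within S, continuous h}. Proof. exact: polar_within e0 hg. Qed.
Let cg : {within S, continuous g}. Proof. exact: polar_within_g e0 hg. Qed.
Let PsiC : in_C Psi. Proof. by case: PsiI. Qed.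
Let GamC : in_C Gam. Proof. by case: GamI. Qed.

(* Derivatives at [t = 0], along [pert h phi t], of [\int Psi (h) dmu] and,
   with the opposite sign, of [\int Gam (g) dlam]. *)
Definition support_variation (phi : V -> R) : R :=
  \int[mu]_(x in (S : set B)) (dt Psi x (h x) * (h x * phi x)).

Definition gauge_variation (phi : V -> R) : R :=
  \int[lam]_(x in (S : set B)) (dt Gam x (g x) * (g x * phi (a x))).

Lemma bm_comp_normal (f : V -> R) :
  bounded_measurable (S : set B) (f : B -> R) ->
  bounded_measurable (S : set B) (fun x : B => f (a x)).
Proof.
move=> [mf [M fM]]; split; last by exists M => x Sx; exact/fM/aS.
apply: (measurable_comp mS _ mf ma) => _ [x Sx <-]; exact: aS.
Qed.

Let bQ (phi : V -> R) : {within S, continuous phi} ->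
  bounded_measurable (S : set B) (fun x : B => dt Psi x (h x) * (h x * phi x)).
Proof.
move=> cp; apply: bmM; first by apply: bm_continuous; exact: within_comp_dt.
by apply: bmM; exact: bm_continuous.
Qed.

Lemma bm_gauge_variation (phi : V -> R) :
  bounded_measurable (S : set B) (phi : B -> R) ->
  bounded_measurable (S : set B) (fun x : B =>
    dt Gam x (g x) * (g x * phi (a x))).
Proof.
move=> cp; apply: bmM; first by apply: bm_continuous; exact: within_comp_dt.
by apply: bmM; [exact: bm_continuous|exact: bm_comp_normal].
Qed.

(** Both functionals would decrease strictly along [pert h phi (t_ k)] for large [k]. Passing to the
    double dual keeps the gauge on the sphere and can only lower [\int Psi (h) dmu] further, which
    contradicts [pareto]. *)
Lemma first_variation (phi : V -> R) : {within S, continuous phi} ->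
  support_variation phi < 0 -> 0 < gauge_variation phi -> False.
Proof.
move=> cp Qn Pp.
have [_ [b1 b1P]] := bm_continuous cp; pose b := `|b1| + 1.
have b0 : 0 < b by rewrite ltr_wpDl.
have phib u : S u -> `|phi u| <= b.
  by move=> Su; rewrite (le_trans (b1P u Su))// /b (le_trans (ler_norm _))//
    lerDl.
(* The factor [(2 * b)^-1] puts every [t_ k], from [k = 0] on, in the range where the denominators
   of [pert] are at least one half. *)
pose t_ (k : nat) : R := (2 * b)^-1 * k.+1%:R^-1.
have t0 k : 0 < t_ k by rewrite mulr_gt0// invr_gt0// mulr_gt0.
have tb k : t_ k * b <= 2^-1.
  rewrite /t_ mulrAC invfM mulfVK ?gt_eqF// ler_piMr ?invr_ge0//.
  by rewrite invf_le1// ler1n.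
have ct : t_ @ \oo --> 0.
  by rewrite -[0](mulr0 (2 * b)^-1); apply: cvgM;
    [exact: cvg_cst|exact: cvg_harmonic].
have e20 : 0 < e / 2 by rewrite divr_gt0.
have e2e : e / 2 <= e by rewrite ler_pdivrMr// ler_peMr ?ler1n// ltW.
pose hk k := pert h phi (t_ k).
have phk k : pinched (e / 2) (hk k)
  by exact: (pinched_pert e0 hg phib (ltW (t0 k)) (tb k)).
have cQ : (fun k => (\int[mu]_(x in (S : set B)) Psi x (hk k x) -
    \int[mu]_(x in (S : set B)) Psi x (h x)) / t_ k)
      @ \oo --> support_variation phi.
  apply: (integral_derivative (e := e / 2) (C := 2 * b / e) (N := set0)) => //.
  - exact: pinched_le e20 e2e (polar_pinched hg).
  - by move=> k; exact: (pert_within e0 hg cp phib (ltW (t0 k)) (tb k)).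
  - by move=> k x Sx; exact: (pert_dist e0 hg b0 phib (ltW (t0 k)) (tb k) Sx).
  - move=> x Sx _.
    rewrite (_ : (fun k => _) = fun k => h x * phi x / (1 - t_ k * phi x));
      last first.
      apply/funext => k; rewrite /hk /pert; field.
      by rewrite !gt_eqF// (pert_denom_gt0 phib (ltW (t0 k)) (tb k) Sx).
    rewrite -[h x * phi x in X in _ --> X]divr1; apply: cvgM;
      first exact: cvg_cst.
    apply: cvgV; first by rewrite oner_eq0.
    rewrite -[X in _ --> X]subr0; apply: cvgB; first exact: cvg_cst.
    by rewrite -[0](mul0r (phi x)); apply: cvgM => //; exact: cvg_cst.
  - by apply: bmM; exact: bm_continuous.
have cP : (fun k => (\int[lam]_(x in (S : set B)) Gam x (dual (hk k) x) -
    \int[lam]_(x in (S : set B)) Gam x (g x)) / t_ k)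
      @ \oo --> - gauge_variation phi.
  have -> : - gauge_variation phi = \int[lam]_(x in (S : set B))
    (dt Gam x (g x) * (- (phi (a x) * g x))).
    rewrite -mulN1r /gauge_variation -bm_integralZl//;
      last by apply: bm_gauge_variation; exact: bm_continuous.
    by apply: eq_integral_on => x Sx; ring.
  apply: (integral_derivative (e := e / 2) (C := 8 * b / e ^+ 3) (N := N)) =>
    //.
  - exact: pinched_le e20 e2e (polar_pinched_g e0 hg).
  - move=> k; apply: continuous_subspaceT;
    exact: dual_continuous e20 (pinched_lb (phk k)).
  - by move=> k; exact: pinched_dual.
  - by move=> k x Sx; exact: (dual_pert_dist e0 hg b0 phib (ltW (t0 k)) (tb k)
    Sx).
  - by move=> x Sx Nx; apply: (dual_pert_derivative e0 hg) tb ct => //;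
    exact: aE.
  - apply: (_ : bounded_measurable _ (fun x : B => - (phi (a x) * g x))).
    have -> : (fun x : B => - (phi (a x) * g x)) =
      (fun x => (-1) * (phi (a x) * g x)).
      by apply/funext => x; rewrite mulN1r.
    apply: bmM; first exact: bm_cst.
    by apply: bmM; [apply: bm_comp_normal;
      exact: bm_continuous|exact: bm_continuous].
have nQ : \forall k \near \oo, (\int[mu]_(x in (S : set B)) Psi x (hk k x) -
    \int[mu]_(x in (S : set B)) Psi x (h x)) / t_ k < 0.
  exact: (cvgr_lt _ cQ).
have nP : \forall k \near \oo,
  (\int[lam]_(x in (S : set B)) Gam x (dual (hk k) x) -
    \int[lam]_(x in (S : set B)) Gam x (g x)) / t_ k < 0.
  by apply: (cvgr_lt _ cP); rewrite oppr_lt0.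
have [k [k1 k2]] := filter_ex (filterI nQ nP).
move: k1 k2; rewrite /= !ltr_pdivrMr// !mul0r !subr_lt0 => k1.
rewrite ltNge => /negP; apply.
have hg' := polar_pair_dual e20 (phk k).
have -> : \int[lam]_(x in (S : set B)) Gam x (dual (hk k) x) =
    \int[lam]_(x in (S : set B)) Gam x (dual (dual (dual (hk k))) x).
  by apply: eq_integral_on => x Sx; rewrite (dual3 e20 (phk k) Sx).
apply: (pareto e20 hg'); apply: le_lt_trans k1; apply: bm_le_integral => //.
- by apply: CI_bm => //;
  [exact: polar_within e20 hg'|move=> x; exact: polar_gt0 e20 hg' x].
- apply: CI_bm => //; first
  exact: (pert_within e0 hg cp phib (ltW (t0 k)) (tb k)).
  by move=> x Sx; exact: pinched_gt0 e20 (phk k) Sx.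
- move=> x Sx; apply: CI_le => //; first exact: (polar_gt0 e20 hg' Sx).
  exact: (dual_dual_le e20 (phk k) Sx).
Qed.

(** On the kernel of [gauge_variation] the linear form [support_variation] is nonnegative: otherwise
    a small positive constant added to [f] would yield a direction excluded by [first_variation].
    Being linear, it vanishes there, and [phi - c] lies in the kernel. *)
Lemma lagrange_multiplier (phi : V -> R) : {within S, continuous phi} ->
  support_variation phi * gauge_variation (fun=> 1) = gauge_variation phi *
    support_variation (fun=> 1).
Proof.
move=> cp.
have c1 c : {within S, continuous (fun=> c : R)} by apply: continuous_subspaceT;
  exact: cst_continuous.
have Qlin (f : V -> R) c d : {within S, continuous f} ->
  support_variation (fun x => c * f x + d) = c * support_variation f + d *
  support_variation (fun=> 1).
  move=> cf; rewrite /support_variation -!bm_integralZl//; try exact: bQ.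
  rewrite -bm_integralD//; try by apply: bmM; [exact: bm_cst|exact: bQ].
  by apply: eq_integral_on => x Sx; ring.
have Plin (f : V -> R) c d : {within S, continuous f} ->
  gauge_variation (fun x => c * f x + d) = c * gauge_variation f + d *
  gauge_variation (fun=> 1).
  move=> cf; have bf := bm_gauge_variation (bm_continuous cf).
  have b1 := bm_gauge_variation (bm_continuous (c1 1)).
  rewrite /gauge_variation -!bm_integralZl//; try exact: bm_gauge_variation.
  rewrite -bm_integralD//; try by apply: bmM; [exact: bm_cst|].
  by apply: eq_integral_on => x Sx; ring.
have clin (f : V -> R) c d : {within S, continuous f} ->
  {within S, continuous (fun x => c * f x + d)}.
  move=> /subspace_continuousP cf; apply/subspace_continuousP => u Su.
  apply: (@cvgD _ _ _ (within S (nbhs u)) _ (fun x => c * f x) (cst d)).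
    by apply: (@cvgM _ _ (within S (nbhs u)) _ (cst c) f);
      [exact: cvg_cst|exact: cf].
  exact: cvg_cst.
have P1 : 0 < gauge_variation (fun=> 1).
  apply: bm_integral_gt0 => //;
    first exact: (@bm_gauge_variation (fun=> 1) (bm_continuous (c1 1))).
  by move=> x Sx; rewrite mulr1 mulr_gt0 ?g0//; case: GamI => _; apply => //;
    exact: g0.
have Q1 : 0 < support_variation (fun=> 1).
  apply: bm_integral_gt0 => //; first exact: bQ.
  by move=> x Sx; rewrite mulr1 mulr_gt0 ?h0//; case: PsiI => _; apply => //;
    exact: h0.
have key f : {within S, continuous f} -> gauge_variation f = 0 ->
  0 <= support_variation f.
  move=> cf Pf; rewrite leNgt; apply/negP => Qf.
  (* The constant perturbation [ep] cancels exactly half of the negative value, leaving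
     [support_variation f / 2]. *)
  pose ep := - support_variation f / (2 * support_variation (fun=> 1)).
  have ep0 : 0 < ep by rewrite divr_gt0 ?oppr_gt0// mulr_gt0.
  apply: (first_variation (clin f 1 ep cf)).
    rewrite Qlin// mul1r /ep.
    have -> : support_variation f + - support_variation f /
      (2 * support_variation (fun=> 1)) * support_variation (fun=> 1) =
      support_variation f / 2.
      by field; rewrite gt_eqF.
    by rewrite pmulr_llt0// invr_gt0.
  by rewrite Plin// Pf mulr0 add0r mulr_gt0.
pose c := gauge_variation phi / gauge_variation (fun=> 1).
have cP1 : c * gauge_variation (fun=> 1) = gauge_variation phi
  by rewrite divfK// gt_eqF.
have k1 := key _ (clin phi 1 (- c) cp); have k2 := key _ (clin phi (-1) c cp).
rewrite !Plin// !Qlin// in k1 k2.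
have {}k1 : 0 <= 1 * support_variation phi + - c * support_variation (fun=> 1)
  by apply: k1; rewrite mulNr cP1; ring.
have {}k2 : 0 <= -1 * support_variation phi + c * support_variation (fun=> 1)
  by apply: k2; rewrite cP1; ring.
have -> : support_variation phi = c * support_variation (fun=> 1) by apply/eqP;
  rewrite eq_le; apply/andP; split; lra.
by rewrite -mulrA (mulrC (support_variation _)) mulrA cP1.
Qed.

End FirstVariation.

(** * From functionals to measures *)

Section IndicatorApprox.
Variables (R : realType) (V : normedModType R).

(** The tents [max 0 (1 - k * d x)], with [d] the distance to [F], tend to the indicator because [d]
    is positive off the closed set [F]. *)
Lemma closed_indic_approx (F : set V) : closed F ->
  exists f_ : nat -> V -> R, [/\ forall k, continuous (f_ k),
    forall k x, 0 <= f_ k x <= 1 &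
    forall x, f_ ^~ x @ \oo --> (\1_F x : R)].
Proof.
(* The distance to an empty set would be the infimum of an empty set, so this case is separate. *)
move=> cF; have [F0|/set0P[y0 Fy0]] := eqVneq F set0.
  exists (fun _ _ => 0); split => [k|k x|x]; first exact: cst_continuous.
    by rewrite lexx ler01.
  by rewrite F0 indicE in_set0; exact: cvg_cst.
pose A x : set R := [set `|x - y| | y in F].
pose d x := inf (A x).
have Ainf x : has_inf (A x).
  by split; [exists `|x - y0|, y0|exists 0 => _ [y _ <-]].
have dle x y : F y -> d x <= `|x - y|.
  by move=> Fy; apply: ge_inf; [case: (Ainf x)|exists y].
have d0 x : 0 <= d x by apply: lb_le_inf; [case: (Ainf x)|move=> _ [y _ <-]].
have dlip1 x x' : d x - d x' <= `|x - x'|.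
  rewrite lerBlDr addrC -lerBlDr; apply: lb_le_inf; first by case: (Ainf x').
  move=> _ [y Fy <-]; rewrite lerBlDr; apply: (le_trans (dle x y Fy)).
  by rewrite -(subrKA x' x (- y)) (le_trans (ler_normD _ _))// addrC.
have dlip x x' : `|d x - d x'| <= `|x - x'|.
  by rewrite ler_norml dlip1 andbT lerNl opprB distrC dlip1.
have dpos x : ~ F x -> 0 < d x.
  move=> Fx; rewrite lt_neqAle d0 andbT eq_sym; apply/eqP => dx; apply: Fx.
  apply: cF => U /nbhs_ballP[r /= r0 rU].
  have [_ [y Fy <-]] := inf_adherent r0 (Ainf x);
    rewrite -/(d x) dx add0r => xy.
  by exists y; split => //; apply: rU; rewrite -ball_normE.
have dcont : continuous d.
  move=> x; apply/(@cvgrPdist_le _ _ _ (nbhs x)) => eps eps0.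
  apply: filterS (nbhsx_ballx x _ eps0) => y; rewrite -ball_normE /= => /ltW.
  exact: le_trans.
exists (fun k x => Num.max 0 (1 - k%:R * d x)); split.
- move=> k x; apply: (@continuous_max R V (cst 0) (fun x => 1 - k%:R * d x)).
    exact: cvg_cst.
  by apply: cvgB; [exact: cvg_cst|apply: cvgM; [exact: cvg_cst|exact: dcont]].
- move=> k x; rewrite le_max lexx/= ge_max ler01/=.
  by rewrite gerBl mulr_ge0.
move=> x; rewrite indicE; have [Fx|Fx] := pselect (F x).
  rewrite mem_set//; have -> : d x = 0.
    by apply/eqP; rewrite eq_le d0 andbT; have := dle x x Fx;
      rewrite subrr normr0.
  under eq_fun do rewrite mulr0 subr0 max_r//.
  exact: cvg_cst.
rewrite memNset//=; apply: cvg_near_cst.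
exists (Num.truncn (d x)^-1).+1 => // k /= Hk; rewrite max_l// subr_le0.
have dx := dpos x Fx; rewrite -ler_pdivrMr// div1r; apply: ltW.
by apply: lt_le_trans (truncnS_gt _) _; rewrite ler_nat.
Qed.

End IndicatorApprox.

Section MeasureIdentification.
Variables (R : realType) (n : nat).
Local Notation V := 'rV[R]_n.
Local Notation B := (Borel R n).
Local Notation S := (@sphere R n).
Variables (mu lam : {measure set B -> \bar R}).
Hypotheses (mufin : (mu S < +oo)%E) (lamfin : (lam S < +oo)%E).
Variables (a : V -> V) (D : V -> R) (c : R).
Hypothesis ma : measurable_fun (S : set B) (a : B -> B).
Hypothesis aS : forall x, S x -> S (a x).
Hypothesis bD : bounded_measurable (S : set B) (D : B -> R).
Hypothesis muE : forall f : V -> R, continuous f ->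
  \int[mu]_(x in (S : set B)) f x = c * \int[lam]_(x in (S : set B))
    (D x * f (a x)).

Let mS := @measurable_sphere R n.

Let P (A : set B) : Prop :=
  \int[mu]_(x in (S : set B)) (\1_A x : R) =
  c * \int[lam]_(x in (S : set B)) (D x * (\1_A (a x) : R)).

Let bm_indic (A : set B) : measurable A ->
  bounded_measurable (S : set B) (fun x : B => \1_A x : R).
Proof.
move=> mA; split; first exact: measurable_indic.
by exists 1 => x _; rewrite indicE; case: (_ \in _); rewrite ?normr1 ?normr0.
Qed.

Let bm_Dcomp (f : V -> R) : bounded_measurable (S : set B) (f : B -> R) ->
  bounded_measurable (S : set B) (fun x : B => D x * f (a x)).
Proof.
move=> [mf [M fM]]; apply: bmM => //; split; last by exists M => x Sx;
  exact/fM/aS.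
apply: (measurable_comp mS _ mf ma) => _ [x Sx <-]; exact: aS.
Qed.

Let P_limit (f_ : nat -> V -> R) (A : set B) : measurable A ->
  (forall k, bounded_measurable (S : set B) (f_ k : B -> R)) ->
  (forall k x, `|f_ k x| <= 1) ->
  (forall x, f_ ^~ x @ \oo --> (\1_A x : R)) ->
  (forall k, \int[mu]_(x in (S : set B)) f_ k x =
     c * \int[lam]_(x in (S : set B)) (D x * f_ k (a x))) -> P A.
Proof.
move=> mA bf f1 cf fE; have [_ [M DM]] := bD.
have c1 : (fun k => \int[mu]_(x in (S : set B)) f_ k x) @ \oo -->
    \int[mu]_(x in (S : set B)) (\1_A x : R).
  apply: (@bm_integral_cvg _ _ _ mu S mS mufin _ _ 1 set0) => //.
  - by move=> k; case: (bf k).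
  - exact: bm_indic.
have c2 : (fun k => \int[lam]_(x in (S : set B)) (D x * f_ k (a x))) @ \oo -->
    \int[lam]_(x in (S : set B)) (D x * (\1_A (a x) : R)).
  apply: (@bm_integral_cvg _ _ _ lam S mS lamfin _ _ M set0) => //.
  - by move=> k; case: (bm_Dcomp (bf k)).
  - by apply: bm_Dcomp; exact: bm_indic.
  - move=> k x Sx; rewrite normrM -[M]mulr1; apply: ler_pM => //; exact: DM.
  - by move=> x Sx _; apply: cvgM; [exact: cvg_cst|exact: cf].
have c3 : (fun k => \int[mu]_(x in (S : set B)) f_ k x) @ \oo -->
    c * \int[lam]_(x in (S : set B)) (D x * (\1_A (a x) : R)).
  by under eq_fun do rewrite fE; apply: cvgM => //; exact: cvg_cst.
exact: cvg_unique c1 c3.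
Qed.

(** Tents carry the identity from continuous functions to closed sets and complements to open ones;
    these are stable under intersection and generate the Borel sets, so Dynkin induction concludes.
    Bounded limits handle countable disjoint unions. *)
Lemma measure_identification (A : set B) : measurable A ->
  \int[mu]_(x in (S : set B)) (\1_A x : R) =
  c * \int[lam]_(x in (S : set B)) (D x * (\1_A (a x) : R)).
Proof.
pose PT (E : set B) := measurable E -> P E.
have PC E : measurable E -> P E -> P (~` E).
  move=> mE PE; rewrite /P.
  have e1 x : \1_(~` E) x = 1 - \1_E x :> R.
    by rewrite !indicE in_setC; case: (x \in E); rewrite ?subrr ?subr0.
  have b1 := bm_indic mE; have b2 := bm_Dcomp b1.
  have b3 : bounded_measurable (S : set B) (fun x : B => D x * cst 1 (a x)).
    by apply: (@bm_Dcomp (cst 1)); exact: bm_cst.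
  have -> : \int[mu]_(x in (S : set B)) (\1_(~` E) x : R) =
      \int[mu]_(x in (S : set B)) cst 1 x - \int[mu]_(x in (S : set B))
        (\1_E x : R).
    rewrite -bm_integralB//; last exact: bm_cst.
    by apply: eq_integral_on => x _; rewrite e1.
  have -> : \int[lam]_(x in (S : set B)) (D x * (\1_(~` E) (a x) : R)) =
      \int[lam]_(x in (S : set B)) (D x * cst 1 (a x)) -
      \int[lam]_(x in (S : set B)) (D x * (\1_E (a x) : R)).
    rewrite -bm_integralB//.
    by apply: eq_integral_on => x _; rewrite e1 mulrBr.
  by rewrite (muE (@cst_continuous _ _ _)) PE mulrBr.
have Pclosed (F : set V) : closed F -> P F.
  move=> cF; have [f_ [cf f01 fF]] := closed_indic_approx cF.
  apply: (@P_limit f_) => //.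
  - exact: measurable_closed.
  - by move=> k; apply: bm_continuous; exact: continuous_subspaceT.
  - by move=> k x; have /andP[f0 f1] := f01 k x; rewrite ger0_norm.
  - by move=> k; exact: muE.
apply: (@dynkin_induction _ B (@open V) P) => //.
- exact: openI.
- exact: Pclosed closedT.
- move=> U oU; rewrite -(setCK U); apply: PC; last by apply: Pclosed;
  exact: open_closedC.
  by apply: measurable_closed; exact: open_closedC.
- move=> F mF tF PF.
  pose U k : set B := \big[setU/set0]_(i < k) F i.
  have mU k : measurable (U k) by apply: bigsetU_measurable.
  have UE k x : \1_(U k) x = \sum_(i < k) \1_(F i) x :> R.
    elim: k => [|k IH]; first by rewrite /U !big_ord0 indicE in_set0.
    rewrite /U !big_ord_recr /= -/(U k) -IH !indicE in_setU.
    have [|] := boolP (x \in F k); last by rewrite orbF addr0.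
    rewrite inE => Fx; suff -> : (x \in U k) = false by rewrite /= add0r.
    apply/negbTE/negP; rewrite inE /U -(bigcup_mkord k F) => -[i /= ik Fi].
    have : i = k by apply: (tF i k) => //; exists x.
    by move=> ikE; rewrite ikE ltnn in ik.
  apply: (@P_limit (fun k x => \1_(U k) x)).
  + exact: bigcup_measurable.
  + by move=> k; exact: bm_indic.
  + by move=> k x; rewrite indicE; case: (_ \in _); rewrite ?normr1 ?normr0.
  + move=> x; apply: cvg_near_cst.
    have [[i _ Fi]|nF] := pselect ((\bigcup_k F k) x).
      exists i.+1 => // k /= ik; rewrite !indicE !mem_set//; first by exists i.
      by rewrite /U -(bigcup_mkord k F); exists i.
    exists 0%N => // k _; rewrite !indicE !memNset//.
    by rewrite /U -(bigcup_mkord k F) => -[i _ Fi]; apply: nF; exists i.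
  + elim=> [|k IH].
      have e0 x : \1_(U 0%N) x = 0 :> R by rewrite /U big_ord0 indicE in_set0.
      have -> : \int[mu]_(x in (S : set B)) (\1_(U 0%N) x : R) = 0.
        rewrite (@eq_integral_on _ _ _ mu S _ (cst 0)) ?Rintegral_cst ?mul0r//.
      rewrite (@eq_integral_on _ _ _ lam S _ (cst 0)) ?Rintegral_cst ?mul0r
        ?mulr0//.
      by move=> x _; rewrite e0 mulr0.
    have eS x : \1_(U k.+1) x = \1_(U k) x + \1_(F k) x :> R.
      by rewrite !UE big_ord_recr.
    have -> : \int[mu]_(x in (S : set B)) (\1_(U k.+1) x : R) =
        \int[mu]_(x in (S : set B)) (\1_(U k) x : R) +
          \int[mu]_(x in (S : set B)) (\1_(F k) x : R).
      rewrite -bm_integralD//; try exact: bm_indic.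
      by apply: eq_integral_on => x _.
    have -> : \int[lam]_(x in (S : set B)) (D x * (\1_(U k.+1) (a x) : R)) =
        \int[lam]_(x in (S : set B)) (D x * (\1_(U k) (a x) : R)) +
        \int[lam]_(x in (S : set B)) (D x * (\1_(F k) (a x) : R)).
      rewrite -bm_integralD//; try by apply: bm_Dcomp; exact: bm_indic.
      by apply: eq_integral_on => x _; rewrite eS mulrDr.
    by rewrite IH PF mulrDr.
Qed.

End MeasureIdentification.

Section LowerIntegral.
Import HBSimple.
Import HBNNSimple.
Context d (T : measurableType d) (R : realType).
Variable mu : {measure set T -> \bar R}.
Implicit Types f : T -> \bar R.

(* The integral of a nonnegative function is a supremum over simple functions
   below it, so it is monotone without any measurability. *)
Lemma ge0_le_integral_nonmeasurable (D : set T) f f' :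
  (forall x, D x -> (0 <= f x)%E) -> (forall x, D x -> (f x <= f' x)%E) ->
  (\int[mu]_(x in D) f x <= \int[mu]_(x in D) f' x)%E.
Proof.
move=> f0 ff'; rewrite !ge0_integralE//; last by move=> x Dx;
  exact: le_trans (f0 x Dx) (ff' x Dx).
apply: ge_ereal_sup => _ [h hf <-]; apply: ereal_sup_ubound.
exists h => // x; apply: le_trans (hf x) _; rewrite /patch.
by case: ifPn => // /set_mem; exact: ff'.
Qed.

(** This is meant for an [f] that may be nonmeasurable, such as the density with its arbitrary
    normals. A simple function below [f] is below [f'] off [N], and conversely [f'] cut off on [N]
    is below [f]. *)
Lemma ge0_eq_integral_off_null (N : set T) f f' : measurable N -> mu N = 0%E ->
  (forall x, (0 <= f x)%E) -> (forall x, (0 <= f' x)%E) ->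
    measurable_fun setT f' ->
  (forall x, ~ N x -> f x = f' x) -> (\int[mu]_x f x = \int[mu]_x f' x)%E.
Proof.
move=> mN N0 f0 f'0 mf' ff'.
have mNC := measurableC mN.
apply/eqP; rewrite eq_le; apply/andP; split.
  rewrite ge0_integralTE//; apply: ge_ereal_sup => _ [h hf <-].
  rewrite -integralT_nnsfun.
  rewrite (ge0_negligible_integral mN measurableT)//; last 2 first.
  - exact/measurable_EFinP/measurable_funTS.
  - by move=> x _; rewrite lee_fin.
  rewrite [leRHS](ge0_negligible_integral mN measurableT)//.
  apply: ge0_le_integral_nonmeasurable => x [_ Nx]; first by rewrite lee_fin.
  by rewrite -ff'//; have := hf x; rewrite patch_setT.
rewrite (ge0_negligible_integral mN measurableT)// integral_mkcond.
apply: ge0_le_integral_nonmeasurable => x _;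
  first by apply: erestrict_ge0 => y _; exact: f'0.
rewrite /patch; case: ifPn => // /set_mem [_ Nx]; by rewrite ff'.
Qed.

Lemma le0_integralN (D : set T) (f : T -> R) : (forall x, D x -> f x <= 0) ->
  (\int[mu]_(x in D) (f x)%:E = - \int[mu]_(x in D) (- f x)%:E)%E.
Proof.
move=> f0; have f0' x : D x -> ((EFin \o f) x <= 0)%E by move=> Dx;
  rewrite lee_fin f0.
rewrite integralE (eq_integral _ _ (le0_funeposE f0')) integral0 add0e.
by rewrite (eq_integral _ _ (le0_funenegE f0')).
Qed.

End LowerIntegral.

(** * Convex bodies and the image measure *)

Section Body.
Variables (R : realType) (n : nat).
Local Notation V := 'rV[R]_n.+1.
Local Notation S := (@sphere R n.+1).
Variables (e : R) (h g : V -> R).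
Hypotheses (e0 : 0 < e) (hg : polar_pair e h g).

Definition gauge_body (k : V -> R) : set V := [set x | k x <= 1].
Local Notation K := (gauge_body g).

Let h0 u : S u -> 0 < h u. Proof. exact: polar_gt0 e0 hg u. Qed.
Let g0 u : S u -> 0 < g u. Proof. exact: polar_gt0_g e0 hg u. Qed.

Lemma gauge_body_norm x : K x -> `|x| <= e^-1.
Proof.
move=> Kx; have [->|xn0] := eqVneq x 0; first by rewrite normr0 invr_ge0 ltW.
have [t [t0 St]] := sphere_normalize xn0.
have xE : x = t^-1 *: (t *: x) by rewrite scalerA mulVf ?scale1r// gt_eqF.
have gx : g (t *: x) <= t.
  by rewrite (polarZ_g e0 hg) ?(ltW t0)// -[leRHS]mulr1 ler_pM2l.
have /andP[eg _] := polar_pinched_g e0 hg St.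
rewrite xE normrZ normfV (gtr0_norm t0) -[e^-1]mulr1.
apply: ler_pM => //; first by rewrite invr_ge0 ltW.
  by rewrite lef_pV2 ?posrE//; exact: le_trans gx.
exact: sphere_norm.
Qed.

Lemma gauge_body_Ko : in_Ko K.
Proof.
split; [|split].
- apply: bounded_closed_compact.
    exists e^-1; split => [|M eM x Kx]; first exact: num_real.
    by apply: le_trans (ltW eM); exact: gauge_body_norm.
  have -> : K = g @^-1` [set y | y <= 1] by [].
  apply: preimage_closed; last exact: closed_le.
  by move=> x _; exact: polar_continuous_g e0 hg _.
- move=> x y t Kx Ky t0 t1; rewrite /gauge_body /=.
  apply: le_trans (polarD_g e0 hg _ _) _.
  have t1' : 0 <= 1 - t by rewrite subr_ge0.
  rewrite !(polarZ_g e0 hg)//.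
  have := ler_wpM2l t0 Kx; have := ler_wpM2l t1' Ky; rewrite !mulr1; lra.
- have L0 : 0 < n.+1%:R / e by rewrite divr_gt0.
  have r0 : 0 < (n.+1%:R / e)^-1 by rewrite invr_gt0.
  apply/nbhs_ballP; exists (n.+1%:R / e)^-1 => //= x;
    rewrite -ball_normE /= sub0r normrN => /ltW xr.
  have := polar_lip_g e0 hg x 0; rewrite subr0.
  have -> : g 0 = 0 by rewrite -(scale0r 0) (polarZ_g e0 hg)// mul0r.
  rewrite subr0 => H; rewrite /gauge_body /=; apply: le_trans (ler_norm _) _.
  by apply: le_trans H _; rewrite mulrC -ler_pdivlMr// mul1r.
Qed.

(** The points [x / g x] lie in the body for all directions [x], and [h = dual g] is the supremum of
    [dotv v x / g x]; this gives the lower bound. *)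
Lemma support_gauge_body v : S v -> Defs.support K v = h v.
Proof.
move=> Sv.
have ub y : K y -> dotv v y <= h v.
  move=> Ky; apply: le_trans (polar_ineq e0 hg y Sv) _.
  by rewrite -[leRHS]mul1r ler_pM2r ?h0.
have sub : has_sup [set dotv v y | y in K].
  split; last by exists (h v) => _ [y Ky <-]; exact: ub.
  exists (dotv v 0), 0 => //; have [_ [_ /nbhs_singleton]] := gauge_body_Ko;
    exact.
apply/eqP; rewrite eq_le; apply/andP; split.
  by apply: ge_sup; [case: sub|move=> _ [y Ky <-]; exact: ub].
apply: (polar_le_g e0 (polar_pair_sym e0 hg)) => x Sx.
apply: ub_le_sup; first by case: sub.
exists ((g x)^-1 *: x); last by rewrite dotvZr dotvC mulrC.
have gx := g0 Sx.
rewrite /gauge_body /= (polarZ_g e0 hg) ?invr_ge0 ?(ltW gx)//.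
by rewrite mulVf ?lt0r_neq0.
Qed.

Lemma radial_gauge_body x : S x -> radial K x = (g x)^-1.
Proof.
move=> Sx; have gx := g0 Sx.
have E : [set t | 0 <= t /\ K (t *: x)] = `[0, (g x)^-1]%classic.
  apply/seteqP; split => t /=; rewrite in_itv /= /gauge_body /=.
    by move=> [t0]; rewrite (polarZ_g e0 hg)// t0 -ler_pdivlMr// div1r.
  by move=> /andP[t0 tg]; split => //;
    rewrite (polarZ_g e0 hg)// -ler_pdivlMr// div1r.
rewrite /radial E; apply/eqP; rewrite eq_le; apply/andP; split.
  apply: ge_sup => [|t /=]; last by rewrite in_itv /= => /andP[].
  by exists 0; rewrite /= in_itv /= lexx invr_ge0 ltW.
apply: ub_le_sup; first by exists (g x)^-1 => t /=;
  rewrite in_itv /= => /andP[].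
by rewrite /= in_itv /= lexx andbT invr_ge0 ltW.
Qed.

Lemma normals_gauge_body x : S x -> normals K x = contact h g x.
Proof.
move=> Sx; have gx := g0 Sx; apply/seteqP; split => v [Sv].
  rewrite radial_gauge_body// support_gauge_body// dotvZl dotvC => H.
  by split => //; rewrite -H mulrA mulfV ?mul1r// gt_eqF.
move=> H; split => //.
rewrite radial_gauge_body// support_gauge_body// dotvZl dotvC H mulrA mulVf
  ?mul1r//.
by rewrite gt_eqF.
Qed.

Lemma alpha_gauge_body x : S x -> contact h g x (alpha K x).
Proof.
move=> Sx; rewrite -normals_gauge_body//; apply: xgetPex.
by rewrite normals_gauge_body//; exact: contact_nonempty e0 hg x.
Qed.

End Body.

Section Separation.
Variables (R : realType) (n : nat).
Local Notation V := 'rV[R]_n.+1.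
Local Notation S := (@sphere R n.+1).
Variable K : set V.
Hypothesis KK : in_Ko K.

Lemma support_has_sup (v : V) : has_sup [set dotv v y | y in K].
Proof.
case: KK => cK [_ iK]; split.
  by exists (dotv v 0), 0 => //; exact: nbhs_singleton iK.
have /compact_bounded[M [_ HM]] := cK.
exists (n.+1%:R * `|v| * (`|M| + 1)) => _ [y Ky <-].
apply: le_trans (ler_norm _) _; apply: le_trans (dotv_norm _ _) _.
apply: ler_wpM2l; first by rewrite mulr_ge0.
by apply: HM => //; rewrite (le_lt_trans (ler_norm _))// ltrDl.
Qed.

Lemma support_ub (v y : V) : K y -> dotv v y <= Defs.support K v.
Proof. by move=> Ky; apply: ub_le_sup; [case: (support_has_sup v)|exists y].
  Qed.

Lemma support_pinched : exists2 e, 0 < e & pinched e (Defs.support K).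
Proof.
case: KK => cK [_ /nbhs_ballP[r /= r0 rK]].
have /compact_bounded[M [_ HM]] := cK.
pose b := n.+1%:R * (`|M| + 1); have b0 : 0 < b by rewrite mulr_gt0// ltr_wpDl.
(* A ball of radius [r] in [K] contains [(r / 2) *: v], which gives the lower bound, and boundedness
   of [K] gives the upper bound [b]. *)
exists (Num.min (r / 2) b^-1); first by rewrite lt_min divr_gt0//= invr_gt0.
move=> v Sv; apply/andP; split.
  rewrite ge_min; apply/orP; left.
  have -> : r / 2 = dotv v ((r / 2) *: v)
    by rewrite dotvZr (Sv : dotv v v = 1) mulr1.
  apply: support_ub; apply: rK; rewrite -ball_normE /= sub0r normrN normrZ.
  rewrite gtr0_norm ?divr_gt0//; apply: (@le_lt_trans _ _ (r / 2 * 1)).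
    by rewrite ler_wpM2l ?divr_ge0 ?(ltW r0)//; exact: sphere_norm.
  by rewrite mulr1 ltr_pdivrMr// ltr_pMr// ltr1n.
apply: (@le_trans _ _ b); last first.
  by rewrite -[leLHS]invrK lef_pV2 ?posrE ?lt_min ?divr_gt0 ?invr_gt0//
    ge_min lexx orbT.
apply: ge_sup; first by case: (support_has_sup v).
move=> _ [y Ky <-]; apply: le_trans (ler_norm _) _.
apply: le_trans (dotv_sphere_norm _ Sv) _; rewrite ler_pM2l//.
by apply: HM => //; rewrite (le_lt_trans (ler_norm _))// ltrDl.
Qed.

(* If [p] is the nearest point of [K], then [x - p] is a separating normal. *)
Lemma separation (x : V) : ~ K x ->
  exists2 u, S u & Defs.support K u < dotv u x.
Proof.
move=> Kx; case: KK => cK [cvx iK].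
pose f y := dotv (x - y) (x - y).
have cf : {within K, continuous f}.
  apply: continuous_subspaceT.
  have cs : continuous (fun y : V => x - y).
    by move=> y; apply: (@cvgB _ _ _ (nbhs y));
      [exact: cvg_cst|exact: (@cvg_id _ (nbhs y))].
  exact: continuous_dotv.
have [p pK pmin] := EVT_min_rV (ex_intro _ 0 (nbhs_singleton iK)) cK cf.
have Kp := set_mem pK; pose w := x - p.
have w0 : w != 0 by rewrite subr_eq0; apply/eqP => xp; apply: Kx; rewrite xp.
have ww : 0 < dotv w w by exact: dotv_gt0.
have wy y : K y -> dotv w (y - p) <= 0.
  move=> Ky; rewrite leNgt; apply/negP => d0.
  set c := dotv w (y - p) in d0; set q := dotv (y - p) (y - p).
  have q0 : 0 <= q by exact: dotvv_ge0.
  have H t : 0 <= t -> t <= 1 -> 2 * t * c <= t ^+ 2 * q.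
    move=> t0 t1; have := pmin _ (mem_set (cvx y p t Ky Kp t0 t1)).
    have E : x - (t *: y + (1 - t) *: p) = w - t *: (y - p).
      by rewrite /w scalerBr scalerBl scale1r !opprD !opprK !addrA;
        congr (_ + _); rewrite addrAC.
    rewrite /f E -/w dotv_sqrB -/c -/q; lra.
  (* For this step the linear gain [2 * t * c] exceeds the quadratic cost [t ^+ 2 * q], so the
     segment towards [y] would come closer to [x] than [p]. *)
  pose t := Num.min 1 (c / (q + 1)).
  have t0 : 0 < t by rewrite lt_min ltr01 divr_gt0// ltr_wpDl.
  have t1 : t <= 1 by rewrite ge_min lexx.
  have tq : t * (q + 1) <= c.
    by rewrite -ler_pdivlMr ?ltr_wpDl// ge_min lexx orbT.
  have := H t (ltW t0) t1; nra.
have [s [s0 Ss]] := sphere_normalize w0; exists (s *: w) => //.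
apply: (@le_lt_trans _ _ (dotv (s *: w) p)).
  apply: ge_sup; first by case: (support_has_sup (s *: w)).
  move=> _ [y Ky <-]; rewrite !dotvZl ler_pM2l// -subr_ge0 -opprB oppr_ge0
    -dotvBr.
  exact: wy.
by rewrite !dotvZl ltr_pM2l// -subr_gt0 -dotvBr.
Qed.

(** By separation a body is the Wulff shape of its support function. The double dual makes the polar
    identities hold as equalities of functions, and homogeneity carries the equality of gauges off
    the sphere. *)
Lemma Ko_gauge_body : exists e h, [/\ 0 < e, polar_pair e h (dual h) &
  K = gauge_body (dual h)].
Proof.
have [e e0 ph] := support_pinched.
pose h := dual (dual (Defs.support K)).
have hg : polar_pair e h (dual h) by apply: polar_pair_dual.
exists e, h; split => //.
have dE x : dual h x = dual (Defs.support K) x.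
  have plb := pinched_lb.
  have [->|xn0] := eqVneq x 0.
    rewrite -(scale0r 0) (polarZ_g e0 hg)// (dualZ e0 (pinched_lb ph))//.
    by rewrite !mul0r.
  have [t [t0 St]] := sphere_normalize xn0.
  have := dual3 e0 ph St; rewrite -/h (polarZ_g e0 hg) ?(ltW t0)//.
  rewrite (dualZ e0 (pinched_lb ph)) ?(ltW t0)//.
  by move=> /(mulfI (lt0r_neq0 t0)).
apply/seteqP; split => x; rewrite /gauge_body /= dE.
  move=> Kx; apply: (dual_le e0 (pinched_lb ph)) => u Su.
  by rewrite ler_pdivrMr ?(pinched_gt0 e0 ph Su)// mul1r; exact: support_ub.
move=> dx; apply: contrapT => /separation[u Su]; apply/negP; rewrite -leNgt.
apply: le_trans (dual_ubM e0 (pinched_lb ph) x Su) _.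
by rewrite -[leRHS]mul1r ler_pM2r// (pinched_gt0 e0 ph).
Qed.

End Separation.

Section Reciprocal.
Variables (R : realType) (n : nat).
Local Notation V := 'rV[R]_n.
Local Notation S := (@sphere R n).
Local Notation D := (@dom_St R n).

(* In the variable [s = 1 / t] the two functionals become increasing functions
   of the support function and of the gauge, in a symmetric way. *)
Definition recip (G : V -> R -> R) (u : V) (s : R) : R := G u s^-1.

Variable G : V -> R -> R.
Hypothesis GC : in_C G.

Let recip_is_derive u (s : R) : S u -> 0 < s ->
  is_derive s 1 (recip G u) (dt G u s^-1 * - s ^- 2).
Proof.
move=> Su s0; have si : 0 < s^-1 by rewrite invr_gt0.
have d1 : is_derive (id s)^-1 1 (G u) (dt G u s^-1) := C_is_derive GC Su si.
have d2 : is_derive s 1 (fun y : R => (id y)^-1) (- (id s) ^- 2 *: 1).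
  by apply: is_deriveV; rewrite gt_eqF.
have := @is_derive1_comp R (G u) (fun y => (id y)^-1) s _ _ d1 d2.
by rewrite -[_ *: 1]/(_ * 1) mulr1.
Qed.

Lemma dt_recip u (s : R) : S u -> 0 < s ->
  dt (recip G) u s = - (dt G u s^-1 * s ^- 2).
Proof.
move=> Su s0; rewrite /dt derive1E.
by case: (recip_is_derive Su s0) => _ ->; rewrite mulrN.
Qed.

Let recip_within (H : V * R -> R) : {within D, continuous H} ->
  {within D, continuous (fun p => H (p.1, p.2^-1))}.
Proof.
move=> /subspace_continuousP cH; apply/subspace_continuousP => p Dp.
have p2 : p.2 != 0 by case: Dp => _ ?; rewrite gt_eqF.
have Dq q : D q -> D (q.1, q.2^-1) by move=> [? ?]; split => //=;
  rewrite invr_gt0.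
have cq : (fun q : V * R => (q.1, q.2^-1)) @ nbhs p --> (p.1, p.2^-1).
  apply: (@cvg_pair _ _ _ (nbhs p) (nbhs p.1) (nbhs p.2^-1) _ _ _ fst
    (fun q => q.2^-1)).
    exact: cvg_fst.
  by apply: (@cvgV _ _ (nbhs p)) => //; exact: cvg_snd.
move=> W nW; have nq : nbhs p [set q : V * R | D (q.1, q.2^-1) ->
  W (H (q.1, q.2^-1))].
  exact: (cq _ (cH _ (Dq p Dp) W nW)).
by apply: (filterS _ nq) => q H1 /Dq; exact: H1.
Qed.

Lemma recip_C : in_C (recip G).
Proof.
case: (GC) => _ [cG cdG]; split; [|split].
- by move=> u t Su t0; case: (recip_is_derive Su t0).
- exact: (recip_within cG).
have c1 := recip_within cdG.
have c2 : {within D, continuous (fun p : V * R =>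
  - (dt G p.1 p.2^-1 * p.2 ^- 2))}.
  apply/subspace_continuousP => p Dp; apply: cvgN; apply: cvgM.
    by move/subspace_continuousP : c1; exact.
  apply: cvg_within_filter; apply: cvgV.
    by case: Dp => _ p0; rewrite expf_neq0// gt_eqF.
  by apply: (@cvgM _ _ (nbhs p)); exact: cvg_snd.
apply: subspace_eq_continuous c2 => p /set_mem [Sp p0].
by rewrite /from_subspace /= dt_recip.
Qed.

Lemma recip_CI : (forall u t, S u -> 0 < t -> dt G u t < 0) -> in_CI (recip G).
Proof.
move=> Gneg; split; first exact: recip_C.
move=> u t Su t0; rewrite dt_recip// oppr_gt0 pmulr_llt0 ?invr_gt0 ?exprn_gt0//.
by apply: Gneg => //; rewrite invr_gt0.
Qed.

Lemma recip_pinfty u : G u t @[t --> 0^'+] --> +oo ->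
  recip G u t @[t --> +oo] --> +oo.
Proof.
move=> H; apply/cvgryPge => A.
move/cvgryPge : H => /(_ A) [r /= r0 Hr].
exists r^-1; split; first exact: num_real.
move=> t tr; have t0 : 0 < t by apply: lt_trans tr; rewrite invr_gt0.
apply: Hr; last by rewrite invr_gt0.
rewrite /= sub0r normrN gtr0_norm ?invr_gt0//.
by rewrite -[ltRHS]invrK ltf_pV2 ?posrE ?invr_gt0.
Qed.

End Reciprocal.

Section Density.
Variables (R : realType) (n : nat).
Local Notation V := 'rV[R]_n.+1.
Local Notation B := (Borel R n.+1).
Local Notation S := (@sphere R n.+1).
Variables (G Psi : V -> R -> R).
Hypothesis GamI : in_CI (recip G).
Hypothesis GC : in_C G.
Hypothesis PsiI : in_CI Psi.
Variables (e : R) (h g : V -> R).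
Hypotheses (e0 : 0 < e) (hg : polar_pair e h g).

Let GamC : in_C (recip G). Proof. by case: GamI. Qed.
Let PsiC : in_C Psi. Proof. by case: PsiI. Qed.
Let h0 u : S u -> 0 < h u. Proof. exact: polar_gt0 e0 hg u. Qed.
Let g0 u : S u -> 0 < g u. Proof. exact: polar_gt0_g e0 hg u. Qed.
Let ch : {within S, continuous h}. Proof. exact: polar_within e0 hg. Qed.
Let cg : {within S, continuous g}. Proof. exact: polar_within_g e0 hg. Qed.

(* In terms of [recip G] the density of the image measure is
   [- dens_num x / dens_den u] at a point with normal [u]. *)
Definition dens_num (x : V) : R := dt (recip G) x (g x) * g x.
Definition dens_den (u : V) : R := h u * dt Psi u (h u).

Lemma dens_num_gt0 x : S x -> 0 < dens_num x.
Proof. by move=> Sx; rewrite mulr_gt0 ?g0//; case: GamI => _; apply => //;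
  exact: g0. Qed.

Lemma dens_den_gt0 u : S u -> 0 < dens_den u.
Proof. by move=> Su; rewrite mulr_gt0 ?h0//; case: PsiI => _; apply => //;
  exact: h0. Qed.

Let within_mul (f1 f2 : V -> R) : {within S, continuous f1} ->
  {within S, continuous f2} ->
  {within S, continuous (fun x => f1 x * f2 x)}.
Proof.
move=> /subspace_continuousP c1 /subspace_continuousP c2.
by apply/subspace_continuousP => x Sx; apply: cvgM; [exact: c1|exact: c2].
Qed.

Lemma dens_num_within : {within S, continuous dens_num}.
Proof. by apply: within_mul => //; exact: within_comp_dt. Qed.

Lemma dens_den_within : {within S, continuous dens_den}.
Proof. by apply: within_mul => //; exact: within_comp_dt. Qed.

Lemma dens_denV_within : {within S, continuous (fun u => (dens_den u)^-1)}.
Proof.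
have /subspace_continuousP c1 := dens_den_within.
apply/subspace_continuousP => x Sx; apply: cvgV; last exact: c1.
by rewrite gt_eqF// dens_den_gt0.
Qed.

Lemma MOG_densityE x : S x ->
  MOG_density G Psi (gauge_body g) x =
    - (dens_num x / dens_den (alpha (gauge_body g) x)).
Proof.
move=> Sx; have gx := g0 Sx.
have [Sa _] := alpha_gauge_body e0 hg Sx.
rewrite /MOG_density (radial_gauge_body e0 hg Sx) (support_gauge_body e0 hg Sa).
rewrite -/(dens_den _) /dens_num (dt_recip GC Sx gx);
  have d0 := dens_den_gt0 Sa.
by field; rewrite !gt_eqF.
Qed.

(** Numerator and denominator have positive extreme values on the compact sphere; bounding them
    separately gives constants valid for whichever normal [alpha] picks. *)
Lemma MOG_density_bounds : exists c1 c2, [/\ 0 < c1, 0 < c2 &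
  forall x, S x -> c1 <= - MOG_density G Psi (gauge_body g) x <= c2].
Proof.
have S0 := sphere_nonempty R n; have cS := @compact_sphere R n.+1.
have [x1 /set_mem S1 m1] := EVT_min_rV S0 cS dens_num_within.
have [x2 /set_mem S2 m2] := EVT_max_rV S0 cS dens_num_within.
have [x3 /set_mem S3 m3] := EVT_min_rV S0 cS dens_den_within.
have [x4 /set_mem S4 m4] := EVT_max_rV S0 cS dens_den_within.
exists (dens_num x1 / dens_den x4), (dens_num x2 / dens_den x3).
have p1 := dens_num_gt0 S1; have p2 := dens_num_gt0 S2.
have p3 := dens_den_gt0 S3; have p4 := dens_den_gt0 S4.
split; rewrite ?divr_gt0// => x Sx.
have [Sa _] := alpha_gauge_body e0 hg Sx; have pa := dens_den_gt0 Sa.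
rewrite MOG_densityE// opprK; apply/andP; split.
  apply: ler_pM; rewrite ?invr_ge0 ?(ltW p1) ?(ltW p4)// ?m1 ?mem_set//.
  by rewrite lef_pV2 ?posrE// m4// mem_set.
apply: ler_pM; rewrite ?invr_ge0 ?(ltW (dens_num_gt0 Sx)) ?(ltW pa)//
  ?m2 ?mem_set//.
by rewrite lef_pV2 ?posrE// m3// mem_set.
Qed.

End Density.

Section Existence.
Variables (R : realType) (n : nat).
Local Notation V := 'rV[R]_n.+1.
Local Notation B := (Borel R n.+1).
Local Notation S := (@sphere R n.+1).
Variables (G Psi : V -> R -> R) (lam mu : {measure set B -> \bar R}).
Hypotheses (GC : in_C G) (GamI : in_CI (recip G)) (PsiI : in_CI Psi).
Hypotheses (lamM : in_M lam) (muN : nonzero_finite_sphere_measure mu).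
Variables (e : R) (h g : V -> R).
Hypotheses (e0 : 0 < e) (hg : polar_pair e h g).
Hypothesis pareto : forall e' h' g', 0 < e' -> polar_pair e' h' g' ->
  \int[mu]_(x in (S : set B)) Psi x (h' x) < \int[mu]_(x in (S : set B)) Psi x
    (h x) ->
  \int[lam]_(x in (S : set B)) recip G x (g x) <= \int[lam]_(x in (S : set B))
    recip G x (g' x).

(** The Lagrange relation says that [mu] is [c] times the image under the normal map of the measure
    with density [D] with respect to [lam]. The Musielak-Orlicz-Gauss image measure is the negative
    of that image, and both [c] and the sign cancel in the quotient. *)
Lemma pareto_normalized_eq : normalized_eq G Psi lam mu (gauge_body g).
Proof.
have mS := @measurable_sphere R n.+1.
have [_ [mupos mufin]] := muN.
have [[_ [lampos lamfin]] _] := lamM.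
have [PsiC _] := PsiI; have [GamC _] := GamI.
have h0 u : S u -> 0 < h u by exact: polar_gt0 e0 hg u.
have g0 u : S u -> 0 < g u by exact: polar_gt0_g e0 hg u.
have [N [a [mN N0 ma aS aE]]] := normal_map e0 hg lamM.
have cnum := dens_num_within GamI e0 hg.
have cdenV := dens_denV_within PsiI e0 hg.
have bdenV := @bm_comp_normal R n a ma aS _ (bm_continuous cdenV).
pose D (x : V) := dens_num G g x / dens_den Psi h (a x).
have bD : bounded_measurable (S : set B) (D : B -> R).
  by apply: bmM => //; exact: bm_continuous.
have D0 x : S x -> 0 < D x.
  move=> Sx; apply: divr_gt0; first exact: (dens_num_gt0 GamI e0 hg).
  by apply: (dens_den_gt0 PsiI e0 hg); exact: aS.
pose P1 := gauge_variation lam (recip G) g a (fun=> 1);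
  pose Q1 := support_variation mu Psi h (fun=> 1).
have c1 : {within S, continuous (fun=> 1 : R)} by apply: continuous_subspaceT;
  exact: cst_continuous.
have ch : {within S, continuous h} by exact: polar_within e0 hg.
have P1pos : 0 < P1.
  apply: bm_integral_gt0 => //.
    exact: (bm_gauge_variation GamI e0 hg ma aS (bm_continuous c1)).
  by move=> x Sx; rewrite mulr1; exact: (dens_num_gt0 GamI e0 hg Sx).
have Q1pos : 0 < Q1.
  apply: bm_integral_gt0 => //.
    apply: bmM; first by apply: bm_continuous; exact: within_comp_dt.
    by apply: bmM; exact: bm_continuous.
  by move=> x Sx; rewrite mulr1 mulrC; exact: (dens_den_gt0 PsiI e0 hg Sx).
pose c := Q1 / P1; have c0 : 0 < c by rewrite divr_gt0.
have muE (f : V -> R) : continuous f ->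
    \int[mu]_(x in (S : set B)) f x = c * \int[lam]_(x in (S : set B))
      (D x * f (a x)).
  (* Dividing by [dens_den] cancels the weight in [support_variation], leaving the integral of
     [f]. *)
  move=> cf; pose phi u := f u * (dens_den Psi h u)^-1.
  have cphi : {within S, continuous phi}.
    move/subspace_continuousP : cdenV => cV; apply/subspace_continuousP => x Sx.
    by apply: cvgM; [apply: cvg_within_filter; exact: cf|exact: cV].
  have := lagrange_multiplier mufin lamfin mupos lampos PsiI GamI e0 hg pareto
    mN N0 ma aS aE cphi.
  have -> : support_variation mu Psi h phi = \int[mu]_(x in (S : set B)) f x.
    apply: eq_integral_on => x Sx;
      rewrite mulrA (mulrC (dt _ _ _)) -/(dens_den Psi h x).
    by rewrite /phi mulrCA mulfV ?mulr1// gt_eqF// (dens_den_gt0 PsiI e0 hg).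
  have -> : gauge_variation lam (recip G) g a phi = \int[lam]_(x in (S : set B))
    (D x * f (a x)).
    apply: eq_integral_on => x Sx; rewrite /phi /D /dens_num; ring.
  rewrite -/P1 -/Q1 => E; apply: (mulIf (lt0r_neq0 P1pos)).
  by rewrite E /c mulrAC divfK ?gt_eqF// mulrC.
have ident := measure_identification mufin lamfin ma aS bD muE.
pose I (A : set B) := \int[lam]_(x in (S : set B)) (D x * (\1_A (a x) : R)).
have muI (A : set B) : measurable A -> A `<=` S -> fine (mu A) = c * I A.
  move=> mA AS; rewrite -ident//.
  by rewrite /Rintegral integral_indic// setIidl.
have bI (A : set B) : measurable A ->
  bounded_measurable (S : set B) (fun x : B => D x * (\1_A (a x) : R)).
  move=> mA; apply: bmM => //;
    apply: (@bm_comp_normal R n a ma aS (\1_A : V -> R)); split.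
    exact: measurable_indic.
  by exists 1 => x _; rewrite indicE; case: (_ \in _); rewrite ?normr1 ?normr0.
have MOGI (A : set B) : measurable A -> A `<=` S ->
    fine (MOG_measure G Psi lam (gauge_body g) A) = - I A.
  move=> mA AS; pose X : set B := alpha_star (gauge_body g) A.
  have XS : X `<=` S by move=> x [].
  have densN x : S x -> MOG_density G Psi (gauge_body g) x < 0.
    move=> Sx; have [Sa _] := alpha_gauge_body e0 hg Sx.
    rewrite (MOG_densityE GC PsiI e0 hg Sx) oppr_lt0 divr_gt0//.
      exact: (dens_num_gt0 GamI e0 hg).
    exact: (dens_den_gt0 PsiI e0 hg).
  rewrite /MOG_measure -/X le0_integralN; last by move=> x /XS Sx;
    exact/ltW/densN.
  rewrite integral_mkcond.
  have DA0 x : S x -> 0 <= D x * (\1_A (a x) : R).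
    by move=> Sx; rewrite mulr_ge0 ?(ltW (D0 x Sx))// indicE; case: (_ \in _).
  pose f' : B -> \bar R := (fun x : B => (D x * (\1_A (a x) : R))%:E) \_ S.
  (* Off [N] the only normal is [a x], so [alpha] agrees with [a] and [alpha_star] with the preimage
     of [A]; the arbitrary choices are confined to the null set. *)
  rewrite (ge0_eq_integral_off_null (f' := f') mN N0).
  - by rewrite -integral_mkcond fineN.
  - by move=> x; apply: erestrict_ge0 => y /XS Sy;
    rewrite lee_fin oppr_ge0 ltW// densN.
  - by move=> x; apply: erestrict_ge0 => y Sy; rewrite lee_fin DA0.
  - apply/(measurable_restrictT _ mS); apply/measurable_EFinP.
    by case: (bI A mA).
  move=> x Nx; rewrite /f' /patch.
  have [xS|xS] := boolP (x \in S); last first.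
    rewrite ifF//; apply/negbTE; apply: contra xS => /set_mem/XS Sx;
      exact: mem_set.
  have Sx := set_mem xS.
  have cE : contact h g x = [set a x] := aE x Sx Nx.
  have nE : normals (gauge_body g) x = [set a x].
    by rewrite (normals_gauge_body e0 hg Sx).
  have XE : (x \in X) = (a x \in A).
    apply/idP/idP => /set_mem H; apply/mem_set.
      by case: H => _ [v []]; rewrite nE => ->.
    by split => //; exists (a x); rewrite nE.
  rewrite XE indicE; case: (_ \in _); last by rewrite mulr0.
  have al : alpha (gauge_body g) x = a x.
    by have := alpha_gauge_body e0 hg Sx; rewrite cE.
  by rewrite mulr1 (MOG_densityE GC PsiI e0 hg Sx) opprK al.
move=> A mA AS; rewrite !muI// !MOGI//.
have IS : 0 < I S.
  have -> : I S = \int[lam]_(x in (S : set B)) D x.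
    apply: eq_integral_on => x Sx; rewrite indicE mem_set ?mulr1//; exact: aS.
  exact: bm_integral_gt0.
by field; rewrite !gt_eqF.
Qed.

End Existence.

(** * Necessity of non-concentration *)

Section Necessity.
Variables (R : realType) (n : nat).
Local Notation V := 'rV[R]_n.+1.
Local Notation B := (Borel R n.+1).
Local Notation S := (@sphere R n.+1).

(** A null open hemisphere would have image measure 0. But the directions in a ball around [u] have
    all their normals in it, [lam] charges that ball, and the density is bounded away from 0. *)
Lemma normalized_eq_not_concentrated (G Psi : V -> R -> R)
    (lam mu : {measure set B -> \bar R}) (K : set V) :
  in_C G -> in_CI (recip G) -> in_CI Psi ->
  (lam S < +oo)%E -> positive_on_open lam ->
  nonzero_finite_sphere_measure mu -> in_Ko K ->
  normalized_eq G Psi lam mu K -> not_concentrated mu.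
Proof.
move=> GC GamI PsiI lamfin lamop [_ [mupos mufin]] KK eqK u Su.
have [e [h [e0 hg KE]]] := Ko_gauge_body KK.
apply/integral_pos_part_gt0; rewrite lt_neqAle measure_ge0 andbT eq_sym.
apply/eqP => mu0.
have mS := @measurable_sphere R n.+1.
have mus : 0 < fine (mu S) by rewrite fine_gt0// mupos mufin.
have EA : fine (MOG_measure G Psi lam K (pos_cap u)) = 0.
  have ES := eqK S mS (@subset_refl _ _).
  have := eqK (pos_cap u) (measurable_pos_cap u) (fun x => @proj1 _ _).
  rewrite mu0 mul0r => /esym/eqP;
    rewrite mulf_eq0 invr_eq0 => /orP[/eqP //|/eqP E0].
  (* Were the total 0, the quotient for the whole sphere would be 0 by the convention for division
     by 0, against 1 on the left. *)
  by move: ES; rewrite E0 invr0 mulr0 mulfV ?gt_eqF// => /eqP; rewrite oner_eq0.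
have [c1 [c2 [c10 c20 bnd]]] := MOG_density_bounds GamI GC PsiI e0 hg.
pose X : set B := alpha_star K (pos_cap u).
have XS : X `<=` S by move=> x [].
rewrite -KE in bnd.
(* A contact direction [v] at [x] satisfies [dotv v x = g x * h v >= e ^+ 2]; within this radius,
   replacing [x] by [u] changes the product by less than that. *)
pose r := e ^+ 2 / n.+1%:R; have r0 : 0 < r by rewrite divr_gt0// exprn_gt0.
pose U : set B := ball u r `&` S.
have oU : open (ball u r) by exact: ball_open.
have mU : measurable U by apply: measurableI => //; exact: measurable_open.
have lamU : (0 < lam U)%E.
  by apply: lamop => //; exists u; split => //; exact: ballxx.
have UX : U `<=` X.
  move=> x [ux Sx]; split => //; have [v cv] := contact_nonempty e0 hg x.
  have [Sv vx] := cv.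
  exists v; rewrite KE (normals_gauge_body e0 hg Sx); split => //; split => //.
  have gh : e ^+ 2 <= dotv v x.
    rewrite vx expr2; apply: ler_pM; rewrite ?(ltW e0)//.
      by case/andP: (polar_pinched_g e0 hg Sx).
    by case/andP: (polar_pinched hg Sv).
  have := dotv_sphere_norm (u - x) Sv; rewrite dotvBr ler_norml => /andP[H _].
  have : n.+1%:R * `|u - x| < e ^+ 2.
    by rewrite mulrC -ltr_pdivlMr//; move: ux; rewrite -ball_normE.
  rewrite (dotvC u v); lra.
have MOGE : MOG_measure G Psi lam K (pos_cap u) =
    (- \int[lam]_(x in X) (- MOG_density G Psi K x)%:E)%E.
  apply: le0_integralN => x /XS Sx; rewrite -oppr_ge0.
  by have /andP[H _] := bnd x Sx; exact: le_trans (ltW c10) H.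
have lowI : (c1%:E * lam U <=
  \int[lam]_(x in X) (- MOG_density G Psi K x)%:E)%E.
  rewrite -integral_cst// [leLHS]integral_mkcond [leRHS]integral_mkcond.
  apply: ge0_le_integral_nonmeasurable => x _.
    by apply: erestrict_ge0 => y _; rewrite lee_fin ltW.
  rewrite /patch; case: ifPn => [/set_mem Ux|_].
    by rewrite ifT ?mem_set//;
      [have /andP[H _] := bnd x (XS _ (UX _ Ux)); rewrite lee_fin|exact: UX].
  by case: ifPn => // /set_mem /XS Sx; rewrite lee_fin;
    have /andP[H _] := bnd x Sx; exact: le_trans (ltW c10) H.
(* Since [fine] sends infinity to 0, a positive lower bound contradicts [EA] only together with
   finiteness. *)
have upI : (\int[lam]_(x in X) (- MOG_density G Psi K x)%:E <= c2%:E * lam S)%E.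
  rewrite -integral_cst// [leLHS]integral_mkcond [leRHS]integral_mkcond.
  apply: ge0_le_integral_nonmeasurable => x _.
    by apply: erestrict_ge0 => y /XS Sy; rewrite lee_fin;
      have /andP[H _] := bnd y Sy; exact: le_trans (ltW c10) H.
  rewrite /patch; case: ifPn => [/set_mem /XS Sx|_].
    by rewrite mem_set//; have /andP[_ H] := bnd x Sx; rewrite lee_fin.
  by case: ifPn => // _; rewrite lee_fin ltW.
move: EA; rewrite MOGE fineN => /eqP; rewrite oppr_eq0; apply/negP.
rewrite gt_eqF// fine_gt0//; apply/andP; split.
  by apply: lt_le_trans lowI; rewrite mule_gt0// lte_fin.
by apply: le_lt_trans upI _; rewrite lte_mul_pinfty// lee_fin ltW.
Qed.

End Necessity.

Theorem theorem5p6 (R : realType) (n : nat) (G Psi : 'rV[R]_n -> R -> R)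
    (lam : {measure set (Borel R n) -> \bar R}) :
  (2 <= n)%N ->
  in_M lam ->
  (* case (a) or case (b) *)
  ((in_CI Psi /\
      (forall xi, sphere xi -> Psi xi t @[t --> +oo] --> +oo) /\
      in_Gd G) \/
   (in_Cd G /\
      (forall xi, sphere xi -> G xi t @[t --> 0^'+] --> +oo) /\
      in_GI Psi)) ->
  (* existence *)
  (not_concentrated lam ->
   forall mu : {measure set (Borel R n) -> \bar R},
     nonzero_finite_sphere_measure mu -> not_concentrated mu ->
     exists K : set 'rV[R]_n, in_Ko K /\ normalized_eq G Psi lam mu K) /\
  (* necessity of the non-concentration condition *)
  (positive_on_open lam ->
   forall mu : {measure set (Borel R n) -> \bar R},
     nonzero_finite_sphere_measure mu ->
     (exists K : set 'rV[R]_n, in_Ko K /\ normalized_eq G Psi lam mu K) ->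
     not_concentrated mu).
Proof.
case: n G Psi lam => [//|n] G Psi lam _ lamM cases.
have [[_ [lampos lamfin]] _] := lamM.
have [GC [Gneg [G0y PsiI]]] : in_C G
  /\ (forall u t, sphere u -> 0 < t -> dt G u t < 0) /\
    (forall xi, sphere xi -> G xi t @[t --> 0^'+] --> +oo) /\ in_CI Psi.
  case: cases => [[PsiI [_ [GC [_ HG]]]]|[[GC Gneg] [G0y [PsiC [_ HP]]]]].
    split => //; split; [|split] => //.
      by move=> u t Su t0; have [H _ _] := HG u Su; exact: H.
    by move=> u Su; have [] := HG u Su.
  split => //; split => //; split => //; split => // u t Su t0.
  by have [H _ _] := HP u Su; exact: H.
have GamI := recip_CI GC Gneg.
have Gamy xi : sphere xi -> recip G xi t @[t --> +oo] --> +oo.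
  by move=> Sx; apply: recip_pinfty; exact: G0y.
have Psiy xi : sphere xi -> Psi xi t @[t --> +oo] --> +oo.
  by move=> Sx; case: cases => [[_ [H _]]|[_ [_ [_ [_ H]]]]];
    [exact: H|have [] := H xi Sx].
split; last first.
  by move=> lamop mu muN [K [KK eqK]];
    exact: normalized_eq_not_concentrated eqK.
move=> nclam mu muN ncmu; have [_ [mupos mufin]] := muN.
suff [e [h [g [e0 hg par]]]] : exists e h g, [/\ 0 < e, polar_pair e h g &
    forall e' h' g', 0 < e' -> polar_pair e' h' g' ->
    \int[mu]_(x in (@sphere R n.+1 : set (Borel R n.+1))) Psi x (h' x) <
    \int[mu]_(x in (@sphere R n.+1 : set (Borel R n.+1))) Psi x (h x) ->
    \int[lam]_(x in (@sphere R n.+1 : set (Borel R n.+1))) recip G x (g x) <=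
    \int[lam]_(x in (@sphere R n.+1 : set (Borel R n.+1))) recip G x (g' x)].
  exists (gauge_body g); split; first exact: gauge_body_Ko e0 hg.
  exact: pareto_normalized_eq e0 hg par.
(* The positive functional is the constrained one: that of [recip G] in case (a), that of [Psi] in
   case (b), where the gauge takes the role of the support function. *)
case: cases => [[_ [_ [_ [Gpos _]]]]|[_ [_ [_ [Psipos _]]]]].
  have Gampos x t : sphere x -> 0 < t -> 0 < recip G x t.
    by move=> Sx t0; apply: Gpos => //; rewrite invr_gt0.
  have [e [h [e0 hg opt]]] :=
    optimal_pair mufin lamfin ncmu nclam PsiI GamI Psiy Gamy Gampos.
  exists e, h, (dual h); split => // e' h' g' e'0 hg' lt.
  case: (hg') => _ _ gE; rewrite leNgt; apply/negP => W.
  move: lt; rewrite ltNge => /negP; apply; apply: (opt e') => //.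
    by rewrite gE in hg'.
  by rewrite -gE ltW.
have [e [k [e0 hg opt]]] :=
  optimal_pair lamfin mufin nclam ncmu GamI PsiI Gamy Psiy Psipos.
exists e, (dual k), k; split => //; first exact: polar_pair_sym e0 hg.
move=> e' h' g' e'0 hg' lt; case: (hg') => _ hE _.
have gh' := polar_pair_sym e'0 hg'; rewrite hE in gh'.
by apply: (opt e') => //; rewrite -hE ltW.
Qed.
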